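(* The following is true. (1) If $P$ is an inscribed $8$-gon, then $T_{3}(P)$ is circumscribed. (2) If $P$ is an inscribed $10$-gon, then $T_{313}(P)$ is circumscribed. (3) ( * ) If $P$ is an inscribed $12$-gon, then $T_{31313}(P)$ is circumscribed.
   Context: The star ( * ) on item (3) is the authors' mark that they do not yet have a proof of that item. $\mathbf{P}$ is the real projective plane, the projectivization of $\mathbb{R}^3$: its points are the lines through the origin of $\mathbb{R}^3$, with homogeneous coordinates $(x:y:z)$, and its lines correspond to the planes through the origin. $\mathbf{P}^*$ is the dual plane, the projectivization of $(\mathbb{R}^3)^*$. Its points are identified with the lines of $\mathbf{P}$, and its lines with the points of $\mathbf{P}$ (a point $v\in\mathbf{P}$ corresponds to the line $v^\perp\subset\mathbf{P}^*$ of linear functions vanishing at $v$). A conic section in $\mathbf{P}$ means a non-degenerate one: the set of points $(x:y:z)$ with $z^2=x^2+y^2\neq 0$, or any image of it under a projective transformation (a map induced by an invertible linear map); conic sections in $\mathbf{P}^*$ are defined likewise. An $n$-gon $P$ in $\mathbf{P}$ is a cyclically ordered collection $\{p_1,\dots,p_n\}$ of points, its vertices, with indices taken mod $n$; its sides are the lines $l_i=\overline{p_ip_{i+1}}$, where $\overline{pq}$ is the line through $p$ and $q$. $n$-gons in $\mathbf{P}^*$ are defined likewise. A polygon is inscribed if its vertices are contained in a conic section, and circumscribed if its sides are tangent to a conic section (in the plane containing the polygon). Here $P$ is a polygon in $\mathbf{P}$. For an $n$-gon $P=\{p_1,\dots,p_n\}$ in $\mathbf{P}$, $T_k(P)$ is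 the $n$-gon in $\mathbf{P}^*$ with vertices $\{\overline{p_1p_{k+1}},\overline{p_2p_{k+2}},\dots,\overline{p_np_{k+n}}\}$, these lines being regarded as points of $\mathbf{P}^*$. For an $n$-gon in $\mathbf{P}^*$, $T_k$ is defined by the same formula and gives an $n$-gon in $\mathbf{P}$: if the vertices are the lines $l_1,\dots,l_n$ of $\mathbf{P}$, the image has vertices $l_i\cap l_{i+k}$. Compositions are written $T_{ab}=T_a\circ T_b$, $T_{abc}=T_a\circ T_b\circ T_c$, and so on, so $T_{313}=T_3\circ T_1\circ T_3$ and $T_{31313}=T_3\circ T_1\circ T_3\circ T_1\circ T_3$. Thus $T_3(P)$, $T_{313}(P)$ and $T_{31313}(P)$ are polygons in $\mathbf{P}^*$.
   Formalization: In each part it is assumed that every polygon involved is defined with consecutive vertices distinct, and that no three distinct sides of the final polygon are concurrent; without the latter, which is necessary for being circumscribed about a non-degenerate conic, the claim fails. *)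

(* Defs.v *)
From HB Require Import structures.
From mathcomp Require Import all_boot all_order all_algebra.
From mathcomp Require Import classical_sets reals.

Set Implicit Arguments.
Unset Strict Implicit.
Unset Printing Implicit Defensive.

Import GRing.Theory.

Local Open Scope ring_scope.
Local Open Scope classical_set_scope.

(* Points and lines of the projectivization of V are the subspaces of V of
   dimension 1 and 2.  Everything that makes sense in a single plane is stated
   for an arbitrary V, and used both for V = R^3 and for V = (R^3)^*. *)

Notation vec3 R := 'rV[R]_3.
Notation covec3 R := 'Hom('rV[R]_3, R^o).

Section Plane.

Variables (R : realType) (V : vectType R).

Definition std_conic : set {vspace vec3 R} :=
  [set <[v]>%VS | v in
     [set v : vec3 R | v 0 2 ^+ 2 = v 0 0 ^+ 2 + v 0 1 ^+ 2 /\ v 0 2 ^+ 2 != 0]].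

(* For V = R^3 the isomorphism phi is an arbitrary projective transformation;
   for V = (R^3)^* it is a projective transformation preceded by the
   identification of R^3 with (R^3)^* given by the dual basis. *)
Definition is_conic (C : set {vspace V}) : Prop :=
  exists2 phi : 'Hom(vec3 R, V),
    bijective phi & C = [set (phi @: U)%VS | U in std_conic].

(* A line meets a conic section in 0, 1 or 2 points; the tangents are the
   lines meeting it in exactly one point. *)
Definition tangent (W : {vspace V}) (C : set {vspace V}) : Prop :=
  \dim W = 2%N /\ exists! U : {vspace V}, C U /\ (U <= W)%VS.

(* The indices live in 'Z_n, which is Z/nZ only for n >= 2. *)
Definition side n (A : 'Z_n -> {vspace V}) (i : 'Z_n) : {vspace V} :=
  (A i + A (i + 1)%R)%VS.

(* The second condition says that consecutive vertices are distinct, so that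
   the sides are lines; no other coincidence of vertices is excluded. *)
Definition is_ngon n (A : 'Z_n -> {vspace V}) : Prop :=
  (forall i, \dim (A i) = 1%N) /\ (forall i, \dim (side A i) = 2%N).

Definition inscribed n (A : 'Z_n -> {vspace V}) : Prop :=
  exists2 C, is_conic C & forall i, C (A i).

Definition circumscribed n (A : 'Z_n -> {vspace V}) : Prop :=
  exists2 C, is_conic C & forall i, tangent (side A i) C.

(* A non-degenerate conic has no three distinct concurrent tangents, so every
   circumscribed polygon has this property. *)
Definition no_three_sides_concurrent n (A : 'Z_n -> {vspace V}) : Prop :=
  forall i j k, side A i != side A j -> side A j != side A k ->
    side A i != side A k -> (side A i :&: side A j :&: side A k = 0)%VS.

End Plane.

Section Duality.

Variable R : realType.

Definition evalv (v : vec3 R) (f : covec3 R) : R^o := f v.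

Fact evalv_is_linear v : linear (evalv v).
Proof. by move=> a f g; rewrite /evalv add_lfunE scale_lfunE. Qed.
HB.instance Definition _ v :=
  GRing.isLinear.Build R (covec3 R) R^o _ (evalv v) (evalv_is_linear v).

(* ann W: the linear functions vanishing on W; preann F: the common zeros of
   the linear functions in F (see mem_ann and mem_preann). *)
Definition ann (W : {vspace vec3 R}) : {vspace covec3 R} :=
  (\bigcap_(v <- vbasis W) lker (linfun (evalv v)))%VS.

Definition preann (F : {vspace covec3 R}) : {vspace vec3 R} :=
  (\bigcap_(f <- vbasis F) lker f)%VS.

Lemma mem_ann (W : {vspace vec3 R}) (f : covec3 R) :
  reflect (forall v, v \in W -> f v = 0) (f \in ann W).
Proof.
rewrite memvE /ann big_tnth; apply: (iffP subv_bigcapP) => fW.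
  move=> v /coord_vbasis ->; rewrite linear_sum big1 // => i _.
  have /seq_tnthP[j ->] : (vbasis W)`_i \in tval (vbasis W).
    by rewrite mem_nth // size_tuple.
  have := fW j isT; rewrite -memvE memv_ker lfunE /= /evalv.
  by rewrite linearZ /= => /eqP ->; rewrite scaler0.
move=> i _; rewrite -memvE memv_ker lfunE /= /evalv fW //.
exact/vbasis_mem/mem_tnth.
Qed.

Lemma mem_preann (F : {vspace covec3 R}) (v : vec3 R) :
  reflect (forall f : covec3 R, f \in F -> f v = 0) (v \in preann F).
Proof.
rewrite memvE /preann big_tnth; apply: (iffP subv_bigcapP) => vF.
  move=> f /coord_vbasis ->; rewrite sum_lfunE big1 // => i _.
  have /seq_tnthP[j ->] : (vbasis F)`_i \in tval (vbasis F).
    by rewrite mem_nth // size_tuple.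
  have := vF j isT; rewrite -memvE memv_ker.
  by rewrite scale_lfunE => /eqP ->; rewrite scaler0.
move=> i _; rewrite -memvE memv_ker vF //.
exact/vbasis_mem/mem_tnth.
Qed.

(* The map T_k from polygons in P to polygons in P^*, and the one from polygons
   in P^* to polygons in P.  A vertex of the image whose two defining points
   (or lines) coincide is not a point, i.e. does not have dimension 1. *)
Definition T n (k : nat) (A : 'Z_n -> {vspace vec3 R}) :
    'Z_n -> {vspace covec3 R} :=
  fun i => ann (A i + A (i + k%:R)%R)%VS.

Definition T' n (k : nat) (A : 'Z_n -> {vspace covec3 R}) :
    'Z_n -> {vspace vec3 R} :=
  fun i => preann (A i + A (i + k%:R)%R)%VS.

End Duality.

(* Main.v *)
(* A point of the conic is the square of a binary linear form, so an inscribed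
   polygon is a sequence u_i of vectors of R^2.  With F = T_1 T_3 acting on
   polygons of points, the claim is that the vertices of F P (n = 8), F^2 P
   (n = 10), F^3 P (n = 12) lie on a conic.

   Six consecutive vertices x_0, ..., x_5 of F Q satisfy Pascal's condition as
   soon as the line x_0 x_5 meets two explicit lines of the figure in one point.
   The lines T_3 F P turn out to be the cross-axes of the projectivities
   u_i -> u_{i+1}, u_{i+4} -> u_{i+3}, u_{i+6} -> u_{i+7}.  For n = 12 the
   chord u_7 u_10 is an explicit linear combination of the axes 3 and 6, and also
   of the axes 4 and 7; eliminating it locates the lines of T_3 F^2 P in two
   pencils of axes, and Pascal's condition reduces to Pluecker relations.  For n
     = 10 the chords T_3 P play the role of the axes.

   Hexagons that overlap in five points in general position lie on one conic.
   Degenerate polygons are reached by a limit: on the line joining u to a generic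
   sample, the 6 x 6 minors of the Veronese matrix are polynomials in the
   parameter that vanish wherever the sample conditions hold.  So there is always
   a nonzero quadratic form vanishing at the vertices, and the absence of three
   collinear vertices allows a non-degenerate one to be chosen. *)

From HB Require Import structures.
Require Import Defs.
From mathcomp Require Import all_boot all_order all_algebra.
From mathcomp Require Import classical_sets reals.
From mathcomp Require Import ring ssrZ.

Set Implicit Arguments.
Unset Strict Implicit.
Unset Printing Implicit Defensive.

Import Order.TTheory GRing.Theory Num.Theory.

Local Open Scope ring_scope.

(** Plain triples, so that identities reduce to [ring] on coordinates and the same constructions run
    over binary integers, polynomials and reals. *)
Definition vec (A : Type) : Type := (A * A * A)%type.

(** * Vectors, lines and points of the projective plane *)

Section Vec.
Variable A : comNzRingType.
Implicit Types (u v w : vec A) (s t : A * A).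

Definition vscale (k : A) v : vec A := (k * v.1.1, k * v.1.2, k * v.2).
Definition vadd v w : vec A := (v.1.1 + w.1.1, v.1.2 + w.1.2, v.2 + w.2).
Definition dot v w : A := v.1.1 * w.1.1 + v.1.2 * w.1.2 + v.2 * w.2.
Definition cross v w : vec A :=
  (v.1.2 * w.2 - v.2 * w.1.2, v.2 * w.1.1 - v.1.1 * w.2,
   v.1.1 * w.1.2 - v.1.2 * w.1.1).
Definition det3 u v w : A := dot u (cross v w).

Definition det2 s t : A := s.1 * t.2 - s.2 * t.1.
Definition veronese s : vec A := (s.1 * s.1, s.1 * s.2, s.2 * s.2).
(** The line through [veronese s] and [veronese t] on the conic y^2 = xz, without the factor
    [det2 s t] of their cross product; for s = t it is the tangent. *)
Definition chord s t : vec A :=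
  (s.2 * t.2, - (s.1 * t.2 + s.2 * t.1), s.1 * t.1).

(* The line through the fixed points of the homography a -> a', b -> b',
   c -> c': it passes through the intersection of ab' and a'b, and so on. *)
Definition axis (a a' b b' c c' : A * A) : vec A :=
  vadd (vscale (det2 b c * det2 a' c') (chord a b'))
       (vscale (- (det2 a c * det2 b' c')) (chord b a')).

(* Difference of the two sides of the equality of cross-ratios expressing that
   the homography a -> a', b -> b', c -> c' sends s to t. *)
Definition cross_defect (a a' b b' c c' s t : A * A) : A :=
  det2 s a * det2 b c * det2 t b' * det2 a' c' - det2 s b * det2 a c * det2 t a'
    * det2 b' c'.

End Vec.

Ltac vec_ring :=
  repeat (match goal with
          | v : vec _ |- _ => destruct v as [[? ?] ?]
          | v : (_ * _)%type |- _ => destruct v as [? ?]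
          end);
  rewrite /det3 /vadd /vscale /dot /cross /veronese /chord /det2 /=;
  try (congr (_, _, _)); ring.

Section VecTheory.
Variable A : comNzRingType.
Implicit Types (u v w : vec A) (s t : A * A).

Lemma cross_veronese s t : cross (veronese s) (veronese t) =
  vscale (det2 s t) (chord s t).
Proof. vec_ring. Qed.

Lemma cross_vscale (k l : A) v w : cross (vscale k v) (vscale l w) =
  vscale (k * l) (cross v w).
Proof. vec_ring. Qed.

Lemma vscaleA (k l : A) v : vscale k (vscale l v) = vscale (k * l) v.
Proof. vec_ring. Qed.

Lemma cross_cross u v w (t : vec A) :
  cross (cross u v) (cross w t) = vadd (vscale (det3 u v t) w) (vscale (- det3 u
    v w) t).
Proof. vec_ring. Qed.

Lemma cross_cross_chain u v w : cross (cross u v) (cross v w) =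
  vscale (det3 u v w) v.
Proof. vec_ring. Qed.

(** The cross-axis joins two Pascal points. Its definition shows it in the pencil of ab' and ba';
    [axis_alt] shows it in the pencil of b'c and bc'. *)
Lemma meet_axis (a a' b b' c c' : A * A) :
  cross (cross (chord a b') (chord a' b)) (cross (chord b' c) (chord b c')) =
  vscale (det2 b b') (axis a a' b b' c c').
Proof. rewrite /axis. vec_ring. Qed.

Lemma axis_alt (a a' b b' c c' : A * A) :
  axis a a' b b' c c' =
  vadd (vscale (det2 a' c' * det2 b a) (chord b' c))
       (vscale (- (det2 a c * det2 b' a')) (chord b c')).
Proof. rewrite /axis. vec_ring. Qed.

(** Inverting the homography and rotating the four pairs preserves the cross-ratio condition, here
    including the sign. *)
Lemma cross_defect_rot (a a' b b' c c' s t : A * A) :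
  cross_defect b' b c' c t s a' a = cross_defect a a' b b' c c' s t.
Proof. rewrite /cross_defect. vec_ring. Qed.

(** With indices mod 12, the chord p7 p10 lies in the pencil of the axes 3 and 6; [chord_axis'] puts
    it in the pencil of the axes 4 and 7. *)
Lemma chord_axis (p0 p1 p3 p4 p6 p7 p9 p10 : A * A) :
  vadd (vscale (det2 p7 p1 * det2 p0 p10) (axis p3 p4 p7 p6 p9 p10))
       (vscale (det2 p10 p4 * det2 p3 p7) (axis p6 p7 p10 p9 p0 p1)) =
  vscale (- cross_defect p0 p1 p4 p3 p6 p7 p10 p9) (chord p7 p10).
Proof. rewrite /axis /cross_defect. vec_ring. Qed.

Lemma chord_axis' (p1 p2 p4 p5 p7 p8 p10 p11 : A * A) :
  vadd (vscale (det2 p7 p1 * det2 p2 p10) (axis p4 p5 p8 p7 p10 p11))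
       (vscale (det2 p10 p4 * det2 p5 p7) (axis p7 p8 p11 p10 p1 p2)) =
  vscale (- cross_defect p1 p2 p5 p4 p7 p8 p11 p10) (chord p7 p10).
Proof. rewrite /axis /cross_defect. vec_ring. Qed.

Definition pascal (a b c d e f : vec A) : A :=
  det3 (cross (cross a b) (cross d e)) (cross (cross b c) (cross e f)) (cross
    (cross c d) (cross f a)).

Lemma pascalE (a b c d e f : vec A) :
  pascal a b c d e f = det3 b c d * det3 d e f * det3 f a b * det3 a c e
   - det3 a b c * det3 c d e * det3 e f a * det3 b d f.
Proof. rewrite /pascal. vec_ring. Qed.

(** Pascal's theorem for the inscribed hexagon p4 p5 p0 p3 p6 p1. *)
Lemma pascal_chords (p0 p1 p3 p4 p5 p6 : A * A) :
  dot (chord p4 p5) (cross (chord p3 p6) (cross (cross (chord p5 p0) (chord p6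
    p1)) (cross (chord p0 p3) (chord p1 p4)))) = 0.
Proof. vec_ring. Qed.

(** The elimination shared by 10-gons and 12-gons. Both terms of the expanded triple product contain
    the brackets of v0 v1 v2 and of v2 v3 v4, so the concurrency of v2, w and the line from the meet
    of n0, n1 to the meet of n5, n6 follows from the last, scalar hypothesis. *)
Lemma concurrency (v0 v1 v2 v3 v4 : vec A) (a0 b0 a1 b1 c0 c1 c3 c4 a5 b5 a6 b6
  : A) n0 n1 n5 n6 w :
  n0 = vadd (vscale a0 v0) (vscale (- b0) v1) ->
  n1 = vadd (vscale a1 v1) (vscale (- b1) v2) ->
  n5 = vadd (vscale a5 v3) (vscale (- b5) v2) ->
  n6 = vadd (vscale a6 v4) (vscale (- b6) v3) ->
  w = vadd (vscale c1 v1) (vscale (- c0) v0) ->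
  w = vadd (vscale c3 v3) (vscale (- c4) v4) ->
  a5 * a6 * b1 * (c1 * a0 - c0 * b0) = a0 * a1 * b5 * (c3 * a6 - c4 * b6) ->
  dot v2 (cross w (cross (cross n5 n6) (cross n0 n1))) = 0.
Proof.
move=> -> -> -> -> e1 e2 e.
set x0 := cross (vadd (vscale a0 v0) _) _; set x5 :=
  cross (vadd (vscale a5 v3) _) _.
have -> : dot v2 (cross w (cross x5 x0)) = dot v2 x5 * dot w x0 - dot v2 x0 *
  dot w x5.
  by clear; move: x0 x5 => x0 x5; vec_ring.
have -> : dot v2 x0 = a0 * a1 * det3 v0 v1 v2 by rewrite /x0; clear; vec_ring.
have -> : dot v2 x5 = a5 * a6 * det3 v2 v3 v4 by rewrite /x5; clear; vec_ring.
have -> : dot w x0 = b1 * (c1 * a0 - c0 * b0) * det3 v0 v1 v2.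
  by rewrite e1 /x0; clear; vec_ring.
have -> : dot w x5 = b5 * (c3 * a6 - c4 * b6) * det3 v2 v3 v4.
  by rewrite e2 /x5; clear; vec_ring.
transitivity (det3 v0 v1 v2 * det3 v2 v3 v4 *
  (a5 * a6 * b1 * (c1 * a0 - c0 * b0) - a0 * a1 * b5 * (c3 * a6 - c4 * b6))).
  by clear; move: (det3 v0 _ _) (det3 v2 _ _) => g h; ring.
by rewrite e subrr mulr0.
Qed.

End VecTheory.

(** * Pascal's theorem for the iterates *)

Section Seq.
Variable A : comNzRingType.
Implicit Types (f : nat -> vec A) (u : nat -> A * A).

(** On coordinate vectors [T k] and [T' k] both become this operation, up to scalars, and [star] is
    the map F. Indices are natural numbers, with periodicity as a separate hypothesis. *)
Definition join k f (i : nat) : vec A := cross (f i) (f (k + i)%N).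
Definition star f := join 1 (join 3 f).
Definition conic_pts u i := veronese (u i).

Definition chord3 u i := chord (u i) (u (3 + i)%N).
Definition axis_at u i :=
  axis (u i) (u (1 + i)%N) (u (4 + i)%N) (u (3 + i)%N) (u (6 + i)%N) (u (7 +
    i)%N).

Lemma eq_join f g k : f =1 g -> join k f =1 join k g.
Proof. by move=> fg i; rewrite /join !fg. Qed.

Lemma join_vscale f g k : (forall i, exists c, f i = vscale c (g i)) ->
  forall i, exists c, join k f i = vscale c (join k g i).
Proof.
move=> fg i; have [c fi] := fg i; have [d fki] := fg (k + i)%N.
by exists (c * d); rewrite /join fi fki cross_vscale.
Qed.

Lemma ex_vscale_trans (v w z : vec A) : (exists c, v = vscale c w) ->
  (exists c, w = vscale c z) -> exists c, v = vscale c z.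
Proof. by move=> [c ->] [d ->]; exists (c * d); rewrite vscaleA. Qed.

Lemma join3_conic_pts u i : exists c, join 3 (conic_pts u) i =
  vscale c (chord3 u i).
Proof. by eexists; rewrite /join /conic_pts cross_veronese. Qed.

Lemma star_conic_pts u i : exists c, star (conic_pts u) i =
  vscale c (join 1 (chord3 u) i).
Proof. exact/join_vscale/join3_conic_pts. Qed.

(** Vertex i of F P is the meet of the chords (i, i+3) and (i+1, i+4), and vertex i+3 that of (i+3,
    i+6) and (i+4, i+7): the two points joined in [meet_axis]. *)
Lemma join3_star_conic_pts u i : exists c, join 3 (star (conic_pts u)) i =
  vscale c (axis_at u i).
Proof.
apply: ex_vscale_trans (join_vscale _ (star_conic_pts u) i) _.
by eexists; rewrite /join /chord3 meet_axis.
Qed.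

(** The side x_i x_{i+1} is the line n_{i+1}. Hence the opposite sides n_1, n_4 meet in y_4 and n_2,
    n_5 in y_5, and only the meet of n_3 with x_5 x_0 remains to be located. *)
Lemma pascal_star (y : nat -> vec A) : exists c,
  let n := join 3 y in let x := join 1 n in
  pascal (x 0) (x 1) (x 2) (x 3) (x 4) (x 5) =
  c * dot (cross (y 4) (y 5)) (cross (n 3) (cross (x 5) (x 0))).
Proof.
set n := join 3 y; set x := join 1 n.
have e i : {c | cross (x i) (x (1 + i)%N) = vscale c (n (1 + i)%N)}.
  by eexists; rewrite /x /join cross_cross_chain.
have e3 i : {c | cross (n i) (n (3 + i)%N) = vscale c (y (3 + i)%N)}.
  by eexists; rewrite /n /join cross_cross_chain.
have [c0 E0] := e 0; have [c1 E1] := e 1; have [c2 E2] := e 2.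
have [c3 E3] := e 3; have [c4 E4] := e 4.
have [k1 K1] := e3 1; have [k2 K2] := e3 2.
exists (c0 * c3 * k1 * (c1 * c4 * k2) * c2) => /=.
rewrite /pascal E0 E1 E2 E3 E4 !cross_vscale K1 K2 !vscaleA.
move: (y 4) (y 5) (n 3) (cross (x 5) _) => a b c d.
by clear; vec_ring.
Qed.

Lemma dot_vscale (k l m1 m2 m3 m4 : A) (a b c d e f : vec A) :
  dot (vscale k a) (cross (vscale l b) (cross (cross (vscale m1 c) (vscale m2
    d)) (cross (vscale m3 e) (vscale m4 f))))
  = k * l * (m1 * m2 * (m3 * m4)) * dot a (cross b (cross (cross c d) (cross e
    f))).
Proof. by clear; vec_ring. Qed.

Lemma join1E f i : join 1 f i = cross (f i) (f i.+1).
Proof. by []. Qed.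

Definition hexagon f i := pascal (f i) (f (1 + i)%N) (f (2 + i)%N) (f (3 + i)%N)
  (f (4 + i)%N) (f (5 + i)%N).

Lemma hexagon8 u : (forall i, u (8 + i)%N = u i) ->
  hexagon (star (conic_pts u)) 0 = 0.
Proof.
move=> u8; rewrite /hexagon /= /star.
have [c /= ->] := pascal_star (conic_pts u).
have L i : {c | join 3 (conic_pts u) i = vscale c (chord3 u i)}.
  by eexists; rewrite /join /conic_pts cross_veronese.
have [c0 E0] := L 0; have [c1 E1] := L 1; have [c3 E3] := L 3.
have [c5 E5] := L 5; have [c6 E6] := L 6.
have cr45 : {d | cross (conic_pts u 4) (conic_pts u 5) =
  vscale d (chord (u 4) (u 5))}.
  by eexists; rewrite cross_veronese.
have [d D] := cr45.
rewrite D E3 !join1E /= E0 E1 E5 E6 dot_vscale /chord3 /= (u8 0) (u8 1).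
by rewrite pascal_chords !mulr0.
Qed.

Lemma hexagon10 u : (forall i, u (10 + i)%N = u i) ->
  hexagon (star (star (conic_pts u))) 0 = 0.
Proof.
move=> u10; rewrite /hexagon /= {1 3 5 7 9 11}/star.
have [c /= ->] := pascal_star (star (conic_pts u)).
have [k0 E0] := join3_star_conic_pts u 0.
have [k1 E1] := join3_star_conic_pts u 1.
have [k3 E3] := join3_star_conic_pts u 3.
have [k5 E5] := join3_star_conic_pts u 5.
have [k6 E6] := join3_star_conic_pts u 6.
have [d D] : exists d, cross (star (conic_pts u) 4) (star (conic_pts u) 5) =
  vscale d (chord3 u 5).
  have [d4 ->] := star_conic_pts u 4; have [d5 ->] := star_conic_pts u 5.
  by eexists; rewrite cross_vscale /join cross_cross_chain vscaleA.
rewrite D E3 !join1E /= E0 E1 E5 E6 dot_vscale.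
have u10' := (u10 0, u10 1, u10 2, u10 3, u10 4); rewrite /= in u10'.
(* The axis i lies in the pencil of the chords i, i+1 by definition and in that of i+3, i+4 by
   [axis_alt]. The coefficients are read off from these two forms, with indices mod 10; the axis 3
   uses both. *)
rewrite (@concurrency _ (chord3 u 3) (chord3 u 4) (chord3 u 5) (chord3 u 6)
  (chord3 u 7)
  (det2 (u 1) (u 7) * det2 (u 4) (u 0)) (det2 (u 0) (u 6) * det2 (u 3) (u 1))
  (det2 (u 2) (u 8) * det2 (u 5) (u 1)) (det2 (u 1) (u 7) * det2 (u 4) (u 2))
  (- (det2 (u 7) (u 9) * det2 (u 4) (u 0))) (- (det2 (u 3) (u 9) * det2 (u 6) (u
    0)))
  (det2 (u 4) (u 0) * det2 (u 7) (u 3)) (det2 (u 3) (u 9) * det2 (u 6) (u 4))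
  (- (det2 (u 5) (u 1) * det2 (u 8) (u 2))) (- (det2 (u 9) (u 1) * det2 (u 6) (u
    2)))
  (- (det2 (u 6) (u 2) * det2 (u 9) (u 3))) (- (det2 (u 0) (u 2) * det2 (u 7) (u
    3)))) ?mulr0 //.
- by rewrite /axis_at axis_alt.
- by rewrite /axis_at axis_alt.
- rewrite /axis_at /axis /chord3 /= !u10'; move: (u 1) (u 2) (u 5) (u 6) (u 8)
  (u 9) => *; clear; vec_ring.
- rewrite /axis_at /axis /chord3 /= !u10'; move: (u 0) (u 2) (u 3) (u 6) (u 7)
  (u 9) => *; clear; vec_ring.
- rewrite /axis_at /axis /chord3 /= !u10'; move: (u 0) (u 3) (u 4) (u 6) (u 7)
  (u 9) => *; clear; vec_ring.
- by rewrite /axis_at axis_alt /chord3 /= !u10'.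
rewrite /det2; move: (u 0) (u 1) (u 2) (u 3) (u 4) (u 5) (u 6) (u 7) (u 8) (u 9).
by clear=> *; vec_ring.
Qed.

End Seq.

(** * Twelve-gons: pencils of axes *)

Section Field.
Variable F : fieldType.

Lemma dot_pencil (a b : vec F) (x y : F) :
  dot (vadd (vscale x a) (vscale y b)) (cross a b) = 0.
Proof. vec_ring. Qed.

Lemma dot_pencilC (a b : vec F) (x y : F) :
  dot (vadd (vscale x b) (vscale y a)) (cross a b) = 0.
Proof. vec_ring. Qed.

Lemma dot_cross_vscale (k : F) (a w x : vec F) : dot a (cross (vscale k w) x) =
  k * dot a (cross w x).
Proof. vec_ring. Qed.

Lemma vscale_vadd (k : F) (a b : vec F) : vscale k (vadd a b) =
  vadd (vscale k a) (vscale k b).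
Proof. vec_ring. Qed.

(** The line xc - yd passes through the meet of c and d, and through that of a and b because it is
    proportional to Q; so it is the join of these points. *)
Lemma meet_pencils (a b c d Q : vec F) (x y z z' : F) :
  x != 0 -> z != 0 -> dot Q (cross a b) = 0 ->
  vscale z (vadd (vscale x c) (vscale (- y) d)) = vscale z' Q ->
  exists k, cross (cross a b) (cross c d) = vscale k (vadd (vscale x c) (vscale
    (- y) d)).
Proof.
move=> x0 z0 Q0 e.
have xy : x * det3 a b c = y * det3 a b d.
  apply/(mulfI z0)/eqP; rewrite -subr_eq0; apply/eqP.
  transitivity (dot (vscale z (vadd (vscale x c) (vscale (- y) d))) (cross a b)).
    by clear; vec_ring.
  by rewrite e; transitivity (z' * dot Q (cross a b)); [clear;
    vec_ring|rewrite Q0 mulr0].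
exists (det3 a b d / x); rewrite cross_cross.
have -> : det3 a b c = y * det3 a b d / x by rewrite -xy mulrC mulKf.
move: (det3 a b d) => k; case: c d {xy e} => [[c1 c2] c3] [[d1 det2] d3].
by rewrite /vadd /vscale /=; congr (_, _, _); field.
Qed.

Lemma cross_cross_swap (a b c d : vec F) : cross (cross a b) (cross c d) =
  cross (cross c d) (cross b a).
Proof. by clear; vec_ring. Qed.

Implicit Types u : nat -> F * F.

(** Measures how far the homography of [axis_at u i] is from sending u_{i+10} to u_{i+9}. *)
Definition defect_at u i :=
  cross_defect (u i) (u (1 + i)%N) (u (4 + i)%N) (u (3 + i)%N) (u (6 + i)%N) (u
    (7 + i)%N)
     (u (10 + i)%N) (u (9 + i)%N).

Definition shift (T : Type) s (f : nat -> T) k := f (k + s)%N.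

(** A shift by 3 exchanges sources and targets and rotates the four pairs. So a 12-gon has only
    three defects, of index 0, 1, 2. *)
Lemma defect_at3 u i : (forall i, u (12 + i)%N = u i) -> defect_at u (3 + i) =
  defect_at u i.
Proof.
by move=> u_per; rewrite /defect_at -[in RHS]cross_defect_rot -!(u_per i)
  -!(u_per (1 + i)%N).
Qed.

(* The line of index 3 of T_3 F^2 P, as a member of the pencil spanned by the
   axes 3, 4 and of the pencil spanned by the axes 6, 7. *)
Definition pencil_lo u :=
   vadd (vscale (det2 (u 2) (u 10) * defect_at u 0) (axis_at u 4))
        (vscale (- (det2 (u 0) (u 10) * defect_at u 1)) (axis_at u 3)).
Definition pencil_hi u :=
   vadd (vscale (det2 (u 3) (u 7) * defect_at u 1) (axis_at u 6))
        (vscale (- (det2 (u 5) (u 7) * defect_at u 0)) (axis_at u 7)).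

Lemma det2C (a b : F * F) : det2 a b = - det2 b a.
Proof. by clear; vec_ring. Qed.

Lemma plucker (b d a c : F * F) :
  det2 b d * det2 a c - det2 a d * det2 b c = det2 b a * det2 d c.
Proof. vec_ring. Qed.

Lemma vscale_transpose (r s : F) (a b c d : vec F) : vscale r (vadd a b) =
  vscale s (vadd c d) ->
  vadd (vscale r a) (vscale (- s) c) = vadd (vscale s d) (vscale (- r) b).
Proof.
move=> [e1 e2 e3]; rewrite /vadd /vscale /= in e1 e2 e3 *.
have h (p q p' q' : F) : r * (p + q) = s * (p' + q') ->
    r * p + - s * p' = s * q' + - r * q.
  move=> e; transitivity (r * (p + q) - s * p' - r * q); first by ring.
  by rewrite e; ring.
by congr (_, _, _); apply: h.
Qed.

Lemma pencils u : (forall i, u (12 + i)%N = u i) ->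
  vscale (det2 (u 7) (u 1)) (pencil_lo u) = vscale (det2 (u 10) (u 4))
    (pencil_hi u).
Proof.
move=> u_per.
have := chord_axis (u 0) (u 1) (u 3) (u 4) (u 6) (u 7) (u 9) (u 10).
have := chord_axis' (u 1) (u 2) (u 4) (u 5) (u 7) (u 8) (u 10) (u 11).
rewrite -/(defect_at u 0) -[cross_defect _ _ _ _ _ _ _ _]/(defect_at u 1).
rewrite /pencil_lo /pencil_hi -[u 0]u_per -[u 1]u_per -[u 2]u_per.
rewrite -[axis _ _ _ _ _ _]/(axis_at u 4) -[axis _ _ _ _ (u 12) _]/(axis_at u 6).
rewrite -[axis _ _ _ _ (u 13) _]/(axis_at u 7) -[axis _ _ _ _ _ _]/(axis_at u 3).
move: (chord _ _) (defect_at u 0) (defect_at u 1) (axis_at _ _) (axis_at _ _)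
  (axis_at _ _) (axis_at _ _).
move: (det2 _ _) (det2 _ _) (det2 _ _) (det2 _ _) (det2 _ _) (det2 _ _).
move=> b1 b2 b3 b4 b5 b6 c r0 r1 m1 m2 m3 m4 e1 e2.
(* Each side is -r0 r1 times the chord u_7 u_10; replacing it by its two expressions through axes
   eliminates it. *)
have : vscale r0 (vscale (- r1) c) = vscale r1 (vscale (- r0) c) by clear;
  vec_ring.
rewrite -e1 -e2 => /vscale_transpose.
move=> e; etransitivity; [|etransitivity; [exact: e|]]; clear; vec_ring.
Qed.

Section Hex12.
Variable u : nat -> F * F.
Hypothesis u_per : forall i, u (12 + i)%N = u i.
Hypothesis d4 : forall i, det2 (u i) (u (4 + i)%N) != 0.
Hypothesis d6 : forall i, det2 (u i) (u (6 + i)%N) != 0.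
Hypothesis xrs0 : forall i, defect_at u i != 0.

Let n := join 3 (star (star (conic_pts u))).

Lemma join3_axes : exists k, n 3 =
  vscale k (cross (cross (axis_at u 3) (axis_at u 4)) (cross (axis_at u 6)
    (axis_at u 7))).
Proof. exact: join_vscale (join_vscale _ (join3_star_conic_pts u)) 3. Qed.

Lemma join3_pencil_hi : exists k, n 3 = vscale k (pencil_hi u).
Proof.
apply: ex_vscale_trans join3_axes _; apply: meet_pencils (esym (pencils u_per)).
- by rewrite mulf_neq0 //; exact: (d4 3).
- by rewrite -(u_per 4); exact: (d6 10).
- exact: dot_pencilC.
Qed.

Lemma join3_pencil_lo : exists k, n 3 = vscale k (pencil_lo u).
Proof.
apply: ex_vscale_trans join3_axes _; rewrite cross_cross_swap;
  apply: meet_pencils (pencils u_per).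
- by rewrite mulf_neq0 // det2C oppr_eq0 -(u_per 2); exact: (d4 10).
- by rewrite -(u_per 1); exact: (d6 7).
- exact: dot_pencil.
Qed.
End Hex12.

Lemma join_periodic (f : nat -> vec F) N k i : (forall i, f (N + i)%N = f i) ->
  join k f (N + i) = join k f i.
Proof. by move=> fN; rewrite /join fN addnCA fN. Qed.

Lemma hexagon12 u : (forall i, u (12 + i)%N = u i) ->
  (forall i, det2 (u i) (u (4 + i)%N) != 0) ->
  (forall i, det2 (u i) (u (6 + i)%N) != 0) ->
  (forall i, defect_at u i != 0) ->
  hexagon (star (star (star (conic_pts u)))) 0 = 0.
Proof.
move=> u_per d4 d6 x0.
have [c /= e] := pascal_star (star (star (conic_pts u))).
rewrite /hexagon {}e.
set n := join 3 _.
have nP s : (exists k, n (3 + s)%N = vscale k (pencil_hi (shift s u))) /\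
            (exists k, n (3 + s)%N = vscale k (pencil_lo (shift s u))).
  have shift12 i : shift s u (12 + i) = shift s u i by rewrite /shift -addnA.
  have d4s i : det2 (shift s u i) (shift s u (4 + i)) != 0 := d4 (i + s)%N.
  have d6s i : det2 (shift s u i) (shift s u (6 + i)) != 0 := d6 (i + s)%N.
  have x0s i : defect_at (shift s u) i != 0 := x0 (i + s)%N.
  split; first exact: (join3_pencil_hi shift12 d4s d6s x0s).
  exact: (join3_pencil_lo shift12 d4s d6s x0s).
have pts12 i : conic_pts u (12 + i)%N = conic_pts u i by rewrite /conic_pts u_per.
have n12 i : n (12 + i)%N = n i by do 5!(apply: join_periodic => {}i).
have [k0 E0] : exists k, n 0 = vscale k (pencil_hi (shift 9 u)).
  by rewrite -n12; apply: (nP 9).1.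
have [k1 E1] : exists k, n 1 = vscale k (pencil_hi (shift 10 u)).
  by rewrite -n12; apply: (nP 10).1.
have [k3 E3] := (nP 0%N).2; have [k5 E5] := (nP 2%N).2; have [k6 E6] :=
  (nP 3%N).2.
have [d D] : exists d, cross (star (star (conic_pts u)) 4) (star (star
  (conic_pts u)) 5) = vscale d (axis_at u 5).
  have [c5 e5] := join3_star_conic_pts u 5.
  by eexists; rewrite /star !join1E cross_cross_chain e5 vscaleA.
rewrite D E3 !join1E E0 E1 E5 E6 dot_vscale.
have ax12 i : axis_at u (12 + i) = axis_at u i by rewrite /axis_at !(addnCA _
  12) !u_per.
have r i : defect_at u (3 + i) = defect_at u i by apply: defect_at3.
have d71 : det2 (u 7) (u 1) != 0 by rewrite -(u_per 1); exact: (d6 7).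
suff -> : dot (axis_at u 5) (cross (pencil_lo (shift 0 u))
     (cross (cross (pencil_lo (shift 2 u)) (pencil_lo (shift 3 u)))
         (cross (pencil_hi (shift 9 u)) (pencil_hi (shift 10 u))))) = 0.
  by rewrite !mulr0.
apply: (mulfI d71); rewrite mulr0 -dot_cross_vscale.
apply: (@concurrency _ (axis_at u 3) (axis_at u 4) (axis_at u 5) (axis_at u 6)
  (axis_at u 7)
  (det2 (u 0) (u 4) * defect_at u 1) (det2 (u 2) (u 4) * defect_at u 0)
  (det2 (u 1) (u 5) * defect_at u 2) (det2 (u 3) (u 5) * defect_at u 1)
  (det2 (u 7) (u 1) * (det2 (u 0) (u 10) * defect_at u 1))
  (det2 (u 7) (u 1) * (det2 (u 2) (u 10) * defect_at u 0))
  (det2 (u 10) (u 4) * (det2 (u 3) (u 7) * defect_at u 1))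
  (det2 (u 10) (u 4) * (det2 (u 5) (u 7) * defect_at u 0))
  (det2 (u 4) (u 0) * defect_at u 2) (det2 (u 2) (u 0) * defect_at u 0)
  (det2 (u 5) (u 1) * defect_at u 0) (det2 (u 3) (u 1) * defect_at u 1)).
- have -> : defect_at u 1 = defect_at u 10 by rewrite -(r 1) -(r 4) -(r 7).
  have -> : defect_at u 0 = defect_at u 9 by rewrite -(r 0) -(r 3) -(r 6).
  by rewrite -(u_per 0) -(u_per 4) -(u_per 2) -(ax12 3) -(ax12 4).
- have -> : defect_at u 1 = defect_at u 10 by rewrite -(r 1) -(r 4) -(r 7).
  have -> : defect_at u 2 = defect_at u 11 by rewrite -(r 2) -(r 5) -(r 8).
  by rewrite -(u_per 1) -(u_per 5) -(u_per 3) -(ax12 4) -(ax12 5).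
- have -> : defect_at u 0 = defect_at u 3 by rewrite -(r 0).
  by rewrite -(u_per 0).
- have -> : defect_at u 0 = defect_at u 3 by rewrite -(r 0).
  have -> : defect_at u 1 = defect_at u 4 by rewrite -(r 1).
  by rewrite -(u_per 1).
- by rewrite /pencil_lo vscale_vadd !vscaleA mulrN.
- by rewrite [LHS](pencils u_per) /pencil_hi vscale_vadd !vscaleA mulrN.
(* Each side contains a difference that a Pluecker relation turns into a product: on u_0, u_2, u_4,
   u_10 and on u_1, u_3, u_5, u_7. *)
transitivity (defect_at u 0 ^+ 2 * defect_at u 1 ^+ 2 * defect_at u 2 * det2 (u
  4) (u 0) * det2 (u 5) (u 1)
   * det2 (u 3) (u 5) * det2 (u 7) (u 1) * (det2 (u 2) (u 0) * det2 (u 10) (u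
     4))).
  rewrite -plucker; move: (det2 _ _) => ?.
  by clear; ring.
rewrite [det2 (u 4) (u 0)]det2C [det2 (u 5) (u 1) in LHS]det2C.
transitivity (defect_at u 0 ^+ 2 * defect_at u 1 ^+ 2 * defect_at u 2 * det2 (u
  0) (u 4) * det2 (u 1) (u 5)
   * det2 (u 2) (u 0) * det2 (u 10) (u 4) * (det2 (u 3) (u 5) * det2 (u 7) (u
     1))).
  by clear; ring.
by rewrite -plucker; clear; ring.
Qed.
End Field.

(** * Conics through overlapping hexagons *)

Section Quad.
Variable A : comNzRingType.
Implicit Types (a b c v w : vec A) (k : vec A * vec A).

(** The standard quadratic transformation: it turns conics through the three coordinate points into
    lines. *)
Definition cross_terms v : vec A := (v.1.2 * v.2, v.1.1 * v.2, v.1.1 * v.1.2).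
Definition squares v : vec A := (v.1.1 * v.1.1, v.1.2 * v.1.2, v.2 * v.2).
Definition quad k v := dot k.1 (squares v) + dot k.2 (cross_terms v).

Definition monomials v : 'rV[A]_6 :=
  \row_j [:: v.1.1 * v.1.1; v.1.2 * v.1.2; v.2 * v.2; v.1.2 * v.2; v.1.1 * v.2;
    v.1.1 * v.1.2]`_j.

Definition comb a b c w := vadd (vadd (vscale w.1.1 a) (vscale w.1.2 b)) (vscale
  w.2 c).
(** Cramer's numerators: coordinates in the frame a, b, c multiplied by [det3 a b c], which avoids
    division. *)
Definition coords a b c v : vec A := (det3 v b c, det3 a v c, det3 a b v).
Definition polars k a b c : vec A :=
  let p v w := quad k (vadd v w) - quad k v - quad k w in (p b c, p a c, p a b).

Lemma comb_coords a b c v : comb a b c (coords a b c v) = vscale (det3 a b c) v.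
Proof. rewrite /comb /coords; vec_ring. Qed.

Lemma det3_comb a b c u v w :
  det3 (comb a b c u) (comb a b c v) (comb a b c w) = det3 a b c * det3 u v w.
Proof. rewrite /comb; vec_ring. Qed.

Lemma quad_vscale k (s : A) v : quad k (vscale s v) = s ^+ 2 * quad k v.
Proof. case: k => k l; rewrite /quad /squares /cross_terms; vec_ring. Qed.

Lemma quad_comb k a b c w :
  quad k (comb a b c w) =
  dot (quad k a, quad k b, quad k c) (squares w) + dot (polars k a b c)
    (cross_terms w).
Proof.
case: k => k l; rewrite /quad /comb /polars /squares /cross_terms /quad /=;
  vec_ring.
Qed.

Lemma pascal_vscale3 a b c d e f (s : A) :
  pascal a b c (vscale s d) (vscale s e) (vscale s f) =
    s ^+ 6 * pascal a b c d e f.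
Proof.
have e1 (x y z : vec A) : det3 x y (vscale s z) = s * det3 x y z by clear;
  vec_ring.
have e2 (x y z : vec A) : det3 x (vscale s y) z = s * det3 x y z by clear;
  vec_ring.
have e3 (x y z : vec A) : det3 (vscale s x) y z = s * det3 x y z by clear;
  vec_ring.
by rewrite !pascalE !(e1, e2, e3) //; clear; ring.
Qed.

(** Pascal's condition says that the quadratic transformation based at a, b, c sends d, e, f to
    collinear points. Scaling d, e, f by [det3 a b c] makes them combinations of a, b, c. *)
Lemma pascal_coords a b c d e f :
  det3 a b c ^+ 6 * pascal a b c d e f = det3 a b c ^+ 4 *
  det3 (cross_terms (coords a b c d)) (cross_terms (coords a b c f))
     (cross_terms (coords a b c e)).
Proof.
rewrite -pascal_vscale3 -!comb_coords.
have ea : a = comb a b c (1, 0, 0) by clear; rewrite /comb; vec_ring.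
have eb : b = comb a b c (0, 1, 0) by clear; rewrite /comb; vec_ring.
have ec : c = comb a b c (0, 0, 1) by clear; rewrite /comb; vec_ring.
move: (coords a b c d) (coords a b c e) (coords a b c f) => x y z.
rewrite {1}ea {2}eb {3}ec pascalE.
rewrite !det3_comb.
move: (det3 a b c) => s; rewrite /cross_terms; clear; vec_ring.
Qed.
End Quad.

Section QuadField.
Variable F : fieldType.
Implicit Types (a b c v w : vec F) (k : vec F * vec F).

Lemma orthogonal_cross (p a b : vec F) : cross a b <> (0, 0, 0) -> dot p a =
  0 -> dot p b = 0 ->
  exists s, p = vscale s (cross a b).
Proof.
case: p a b => [[p1 p2] p3] [[a1 a2] a3] [[b1 b2] b3] ab pa pb.
have e : cross (cross (a1, a2, a3) (b1, b2, b3)) (p1, p2, p3) = (0, 0, 0).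
  have -> v w z : cross (cross v w) z = vadd (vscale (dot z v) w) (vscale (- dot
    z w) v) :> vec F.
    by clear; vec_ring.
  by rewrite pa pb /vadd /vscale /= !(mul0r, oppr0, addr0).
move: ab e; case: (cross _ _) => [[c1 c2] c3] c0 [/eqP e1 /eqP e2 /eqP e3].
move: e1 e2 e3; rewrite /= !subr_eq0 => /eqP e1 /eqP e2 /eqP e3.
(* Over a general field [dot] may be isotropic, so the factor is read off from a nonzero coordinate
   of the cross product. *)
have [c1_0|c1_0] := eqVneq c1 0; last first.
  exists (p1 / c1); rewrite /vscale /=; congr (_, _, _); apply: (mulfI c1_0).
  - by field.
  - by rewrite e3; field.
  - by rewrite -e2; field.
have [c2_0|c2_0] := eqVneq c2 0; last first.
  exists (p2 / c2); rewrite /vscale /=; congr (_, _, _); apply: (mulfI c2_0).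
  - by rewrite -e3; field.
  - by field.
  - by rewrite e1; field.
have [c3_0|c3_0] := eqVneq c3 0; last first.
  exists (p3 / c3); rewrite /vscale /=; congr (_, _, _); apply: (mulfI c3_0).
  - by rewrite e2; field.
  - by rewrite -e1; field.
  - by field.
by rewrite c1_0 c2_0 c3_0 in c0.
Qed.

(* Two conics through five points in general position coincide. *)
Lemma quad6 k a b c d e f :
  det3 a b c != 0 -> det3 a b d != 0 -> det3 a b e != 0 -> det3 c d e != 0 ->
  quad k a = 0 -> quad k b = 0 -> quad k c = 0 -> quad k d = 0 -> quad k e = 0 ->
  pascal a b c d e f = 0 -> quad k f = 0.
Proof.
move=> abc abd abe cde ka kb kc kd ke P.
have D v : det3 a b c ^+ 2 * quad k v =
    dot (polars k a b c) (cross_terms (coords a b c v)).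
  rewrite -quad_vscale -comb_coords quad_comb ka kb kc.
  by rewrite [dot (0, 0, 0) _]/dot /= !mul0r !add0r.
have := pascal_coords a b c d e f; rewrite P mulr0 => /esym/eqP.
rewrite mulf_eq0 expf_eq0 (negPf abc) andbF /= => /eqP.
have Pd : dot (polars k a b c) (cross_terms (coords a b c d)) = 0.
  by rewrite -D kd mulr0.
have Pe : dot (polars k a b c) (cross_terms (coords a b c e)) = 0.
  by rewrite -D ke mulr0.
(* The images of d and e are independent, as the last coordinate of their cross product is a product
   of brackets. So the line [polars k a b c] is the line joining them, up to a scalar, and Pascal's
   condition puts the image of f on it. *)
have ne : cross (cross_terms (coords a b c d)) (cross_terms (coords a b c e)) <>
  (0, 0, 0).
  have e2 : (cross (cross_terms (coords a b c d)) (cross_terms (coords a b c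
    e))).2 = det3 a b d * det3 a b e * det3 a b c * det3 c e d.
    by clear; rewrite /cross_terms /coords; vec_ring.
  move=> e0; move: e2; rewrite e0 /= => /esym/eqP.
  have -> : det3 c e d = - det3 c d e by clear; vec_ring.
  by rewrite !mulf_eq0 oppr_eq0 (negPf abc) (negPf abd) (negPf abe) (negPf cde).
have [s es] := orthogonal_cross ne Pd Pe.
move=> B; apply/eqP; rewrite -(mulrI_eq0 _ (mulfI (expf_neq0 2 abc))) D es.
move: B; move: (cross_terms (coords a b c d)) (cross_terms (coords a b c e))
  (cross_terms (coords a b c f)) => x y z B.
have -> : dot (vscale s (cross x y)) z = - s * det3 x z y by clear; vec_ring.
by rewrite B mulr0.
Qed.

Definition formof (c : 'rV[F]_6) : vec F * vec F :=
  let g j := c 0 (inord j) in ((g 0%N, g 1%N, g 2%N), (g 3%N, g 4%N, g 5%N)).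

Lemma quad_formof (c : 'rV[F]_6) v : c *m (monomials v)^T =
  (quad (formof c) v)%:M.
Proof.
apply/matrixP=> i j; rewrite !ord1 !mxE !big_ord_recl big_ord0 !mxE /= mulr1n.
rewrite /quad /formof /dot /= !addrA addr0.
by do !congr (_ + _); congr (c _ _ * _); apply/val_inj; rewrite /= inordK.
Qed.

Lemma five_conic (x : nat -> vec F) : exists2 c : 'rV[F]_6, c != 0 &
  forall i, (i < 5)%N -> quad (formof c) (x i) = 0.
Proof.
pose M := \matrix_(i < 5) monomials (x i).
have /rowV0Pn[c cM c0] : kermx M^T != 0.
  rewrite kermx_eq0 /row_free neq_ltn; apply/orP; left.
  exact: leq_ltn_trans (rank_leq_col _) _.
exists c => // i i5; have /sub_kermxP/(congr1 (fun m : 'rV_5 =>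
  m 0 (Ordinal i5))) := cM.
rewrite mxE [RHS]mxE => e.
have := congr1 (fun m : 'M_1 => m 0 0) (quad_formof c (x i)).
rewrite mxE [RHS]mxE mulr1n => <-; rewrite -[RHS]e.
by apply: eq_bigr => j _; rewrite !mxE.
Qed.

Lemma hexagons_conic (x : nat -> vec F) :
  (forall i, det3 (x i) (x (1 + i)%N) (x (2 + i)%N) != 0) ->
  (forall i, det3 (x i) (x (1 + i)%N) (x (3 + i)%N) != 0) ->
  (forall i, det3 (x i) (x (1 + i)%N) (x (4 + i)%N) != 0) ->
  (forall i, hexagon x i = 0) ->
  exists2 c : 'rV[F]_6, c != 0 & forall i, quad (formof c) (x i) = 0.
Proof.
move=> n2 n3 n4 h; have [c c0 c5] := five_conic x; exists c => //.
(* The window of five points starting at i moves along the sequence; each new point is the sixth of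
   a hexagon. *)
suff H i j : (j < 5)%N -> quad (formof c) (x (j + i)%N) = 0 by move=> i;
  apply: (H i 0%N).
elim: i j => [|i IH] j j5; first by rewrite addn0 c5.
rewrite addnS -addSn; move: j5; rewrite leq_eqVlt => /orP[/eqP[->]|/IH//].
apply: (quad6 (n2 i) (n3 i) (n4 i) (n2 (2 + i)%N)); try exact: h.
- exact: (IH 0%N).
- exact: (IH 1%N).
- exact: (IH 2%N).
- exact: (IH 3%N).
- exact: (IH 4%N).
Qed.

End QuadField.

(** * Specialization from generic polygons *)

Section Generic.
Variable A : comNzRingType.
Implicit Types (u : nat -> A * A) (x : nat -> vec A).

Definition stars m f : nat -> vec A := iter m (@star A) f.

(** The quantities over one period that must not vanish: brackets for [quad6], then factors for
    [meet_pencils]. As a list they can be mapped by a ring morphism, multiplied together and tested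
    by computation. *)
Definition genericity N m u : seq A :=
  flatten [seq
    [:: det3 (stars m (conic_pts u) i) (stars m (conic_pts u) (1 + i)%N) (stars
      m (conic_pts u) (2 + i)%N);
        det3 (stars m (conic_pts u) i) (stars m (conic_pts u) (1 + i)%N) (stars
          m (conic_pts u) (3 + i)%N);
        det3 (stars m (conic_pts u) i) (stars m (conic_pts u) (1 + i)%N) (stars
          m (conic_pts u) (4 + i)%N);
        det2 (u i) (u (4 + i)%N); det2 (u i) (u (6 + i)%N);
        cross_defect (u i) (u (1 + i)%N) (u (4 + i)%N) (u (3 + i)%N) (u (6 +
          i)%N) (u (7 + i)%N)
     (u (10 + i)%N) (u (9 + i)%N)] | i <- iota 0 N].

Lemma eq_stars m u v : u =1 v -> stars m (conic_pts u) =1 stars m (conic_pts v).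
Proof.
move=> uv; elim: m => [|m IH] i; first by rewrite /= /conic_pts uv.
by rewrite /= /star; do 2!(apply: eq_join => {}i).
Qed.

Lemma eq_genericity N m u v : u =1 v -> genericity N m u = genericity N m v.
Proof.
move=> uv; rewrite /genericity; congr flatten; apply: eq_map => i.
by rewrite !(eq_stars _ uv) !uv.
Qed.

End Generic.

(** * Compatibility with ring morphisms *)

Section Morph.
Variables (A B : comNzRingType) (phi : {rmorphism A -> B}).
Definition map_vec (v : vec A) : vec B := (phi v.1.1, phi v.1.2, phi v.2).
Definition map_pair (s : A * A) : B * B := (phi s.1, phi s.2).

Lemma map_vec_cross v w : map_vec (cross v w) = cross (map_vec v) (map_vec w).
Proof. by rewrite /map_vec /cross /= !(rmorphB, rmorphM). Qed.

Lemma det3_map_vec u v w : det3 (map_vec u) (map_vec v) (map_vec w) =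
  phi (det3 u v w).
Proof. by rewrite /det3 -map_vec_cross /dot /= !(rmorphD, rmorphM). Qed.

Lemma det2_map_pair s t : det2 (map_pair s) (map_pair t) = phi (det2 s t).
Proof. by rewrite /det2 rmorphB !rmorphM. Qed.

Lemma join_map_vec f k i : join k (map_vec \o f) i = map_vec (join k f i).
Proof. by rewrite /join map_vec_cross. Qed.

Lemma stars_map_pair m u i : stars m (conic_pts (map_pair \o u)) i =
  map_vec (stars m (conic_pts u) i).
Proof.
elim: m i => [|m IH] i; first by rewrite /= /conic_pts /veronese /map_vec /=
  !rmorphM.
rewrite /= /star (eq_join 1 (g := map_vec \o join 3 (stars m (conic_pts u))))
  ?join_map_vec //.
by move=> {}i; rewrite (eq_join 3 IH) join_map_vec.
Qed.

Lemma genericity_map_pair N m u : genericity N m (map_pair \o u) =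
  [seq phi z | z <- genericity N m u].
Proof.
rewrite /genericity map_flatten -map_comp; congr flatten; apply: eq_map => i /=.
rewrite !stars_map_pair !det3_map_vec !det2_map_pair; congr [:: _; _; _; _; _; _].
by rewrite /cross_defect !det2_map_pair !(rmorphB, rmorphM).
Qed.
End Morph.

Section Field.
Variable F : fieldType.
Implicit Types u : nat -> F * F.

(** N vertices and m applications of F; the vertices of F^m P are the sides of T_3 F^(m-1) P. *)
Definition admissible (N m : nat) := (N, m) \in [:: (8, 1); (10, 2); (12, 3)]%N.

Lemma stars_shift m u s i : stars m (conic_pts u) (i + s)%N =
  stars m (conic_pts (shift s u)) i.
Proof.
elim: m i => // m IH i; rewrite /= /star /join -!IH.
by rewrite -!addnA.
Qed.

Lemma periodic_mod T (f : nat -> T) N i : (forall i, f (N + i)%N = f i) -> f i =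
  f (i %% N)%N.
Proof.
move=> fN; rewrite [in LHS](divn_eq i N); elim: (i %/ N)%N => [|k IH];
  first by rewrite mul0n.
by rewrite mulSn -addnA fN.
Qed.

Lemma periodic_modDr T (f : nat -> T) N k i : (forall i, f (N + i)%N = f i) ->
  f (k + i %% N)%N = f (k + i)%N.
Proof.
by move=> fN; rewrite (periodic_mod _ fN) modnDmr -(periodic_mod _ fN).
Qed.

Lemma stars_periodic m u N : (forall i, u (N + i)%N = u i) ->
  forall i, stars m (conic_pts u) (N + i)%N = stars m (conic_pts u) i.
Proof.
move=> uN; elim: m => [|m IH] i; first by rewrite /= /conic_pts uN.
by rewrite /=; do 2!(apply: join_periodic => {}i).
Qed.

Lemma generic_conic N m u : admissible N m -> (forall i, u (N + i)%N = u i) ->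
  all (fun z => z != 0) (genericity N m u) ->
  exists2 c : 'rV[F]_6, c != 0 & forall i, quad (formof c) (stars m (conic_pts
    u) i) = 0.
Proof.
move=> Nm uN /allP g.
have N0 : (0 < N)%N by move: Nm; rewrite /admissible !inE => /or3P[] /eqP[-> _].
have gi i : all (fun z => z != 0)
    [:: det3 (stars m (conic_pts u) i) (stars m (conic_pts u) (1 + i)%N) (stars
      m (conic_pts u) (2 + i)%N);
        det3 (stars m (conic_pts u) i) (stars m (conic_pts u) (1 + i)%N) (stars
          m (conic_pts u) (3 + i)%N);
        det3 (stars m (conic_pts u) i) (stars m (conic_pts u) (1 + i)%N) (stars
          m (conic_pts u) (4 + i)%N);
        det2 (u i) (u (4 + i)%N); det2 (u i) (u (6 + i)%N); defect_at u i].
  have xP k : stars m (conic_pts u) (k + i) = stars m (conic_pts u) (k + i %% N).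
    by rewrite -(periodic_modDr _ _ (stars_periodic m uN)).
  have uP k : u (k + i)%N = u (k + i %% N)%N by rewrite -(periodic_modDr _ _ uN).
  have x0 := xP 0%N; have u0 := uP 0%N; rewrite !add0n in x0 u0.
  apply/allP => z; rewrite /defect_at !xP !uP x0 u0 => zi; apply: g.
  by apply/flatten_mapP; exists (i %% N)%N; rewrite ?mem_iota ?ltn_pmod.
apply: hexagons_conic => i; try by have /and5P[] := gi i.
have -> : hexagon (stars m (conic_pts u)) i = hexagon (stars m (conic_pts (shift
  i u))) 0.
  by rewrite /hexagon !addn0 -!stars_shift add0n.
have vN k : shift i u (N + k)%N = shift i u k by rewrite /shift -addnA.
move: Nm; rewrite /admissible !inE => /or3P[] /eqP[eN em];
  rewrite {}eN {}em in vN *.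
- exact: hexagon8.
- exact: hexagon10.
have gs k : all (fun z => z != 0) [:: det2 (u (k + i)%N) (u (4 + k + i)%N);
  det2 (u (k + i)%N) (u (6 + k + i)%N); defect_at (shift i u) k].
  by have /and5P[_ _ _ ? /and3P[? ? _]] := gi (k + i)%N; apply/and4P; split.
by apply: hexagon12 => // k; have /and4P[] := gs k.
Qed.

End Field.

(* The sample is evaluated in the binary integers, where the genericity
   conditions can be checked by computation. *)
Definition sample (A : comNzRingType) (N i : nat) : A * A :=
  (1, (nth 0 [:: 0; 1; 3; 4; 9; 11; 16; 21; 24; 31; 37; 42] (i %% N))%N%:R).

Lemma sample_generic N m : admissible N m ->
  all (fun z => z != 0) (genericity N m (sample BinNums.Z N)).
Proof.
by rewrite /admissible !inE => /or3P[] /eqP[-> ->]; vm_compute.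
Qed.

(** * From generic to arbitrary polygons *)

Section Density.
Variable R : numFieldType.

(** The product pq vanishes everywhere, in particular at more natural numbers than its degree, and
    these are distinct in R. *)
Lemma poly_eq0_of_vanish (p q : {poly R}) : q != 0 ->
  (forall e, q.[e] != 0 -> p.[e] = 0) -> p = 0.
Proof.
move=> q0 pq; apply/eqP; rewrite -[p == 0]orbF -(negPf q0) -mulf_eq0; apply/eqP.
apply: (@roots_geq_poly_eq0 _ _ [seq k%:R | k <- iota 0 (size (p * q))]).
- apply/allP => e _; rewrite rootM !rootE; have [//|qe] := eqVneq q.[e] 0.
    by rewrite orbT.
  by rewrite pq ?eqxx.
- rewrite map_inj_uniq ?iota_uniq // => i j /eqP.
  by rewrite eqr_nat => /eqP.
- by rewrite size_map size_iota.
Qed.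

Lemma map_vec_monomials (A B : comNzRingType) (phi : {rmorphism A -> B}) v j :
  monomials (map_vec phi v) 0 j = phi (monomials v 0 j).
Proof.
rewrite !mxE; case: j => [[|[|[|[|[|[|j]]]]]] j6] //=; by rewrite rmorphM.
Qed.

Lemma mul_monomials (x : nat -> vec R) (c : 'rV[R]_6) n (f : 'I_n ->
  nat) (i : 'I_n) :
  (c *m (\matrix_i monomials (x (f i)))^T) 0 i = quad (formof c) (x (f i)).
Proof.
have := congr1 (fun m : 'M_1 => m 0 0) (quad_formof c (x (f i))).
rewrite mxE [RHS]mxE mulr1n => <-; rewrite mxE.
by apply: eq_bigr => j _; rewrite !mxE.
Qed.

(** A Veronese matrix of rank 6 would contain six rows with nonzero determinant; a smaller rank
    leaves a quadratic form in the kernel. *)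
Lemma conic_of_minors (x : nat -> vec R) N :
  (forall f : 'I_6 -> nat, \det (\matrix_i monomials (x (f i))) = 0) ->
  exists2 c : 'rV[R]_6, c != 0 & forall i : 'I_N, quad (formof c) (x i) = 0.
Proof.
move=> d0; pose M := \matrix_(i < N) monomials (x i).
have /rowV0Pn[c cM c0] : kermx M^T != 0.
  rewrite kermx_eq0 /row_free mxrank_tr; apply/negP => fM.
  have := fullrowsub_unit fM.
  have -> : rowsub (fullrankfun fM) M = \matrix_i monomials (x (fullrankfun fM
    i)).
    by apply/matrixP => i j; rewrite !mxE.
  by rewrite unitmxE (d0 (fun i => fullrankfun fM i)) unitr0.
exists c => // i; have /sub_kermxP/(congr1 (fun m : 'rV_N => m 0 i)) := cM.
by rewrite mul_monomials mxE.
Qed.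

Lemma conic_minors0 (x : nat -> vec R) (c : 'rV[R]_6) (f : 'I_6 ->
  nat) : c != 0 ->
  (forall i, quad (formof c) (x i) = 0) -> \det (\matrix_i monomials (x (f i)))
    = 0.
Proof.
move=> c0 cx; apply/eqP; rewrite -det_tr; apply/det0P; exists c => //.
by apply/rowP => i; rewrite mul_monomials cx mxE.
Qed.

Lemma stars_conic (N m : nat) (u : nat -> R * R) : admissible N m -> (forall i,
  u (N + i)%N = u i) ->
  exists2 c : 'rV[R]_6, c != 0 & forall i, quad (formof c) (stars m (conic_pts
    u) i) = 0.
Proof.
move=> Nm uN.
have N0 : (0 < N)%N by move: Nm; rewrite /admissible !inE => /or3P[] /eqP[-> _].
have W : all (fun z => z != 0) (genericity N m (sample R N)).
  pose phi : {rmorphism BinNums.Z -> R} := intr \o int_of_Z.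
  have sE : sample R N =1 map_pair phi \o sample BinNums.Z N.
    by move=> i; congr (_, _); apply/esym/(rmorph_nat phi).
  have -> : genericity N m (sample R N) = [seq phi z | z <- genericity N m
    (sample BinNums.Z N)].
    by rewrite -genericity_map_pair (eq_genericity _ _ sE).
  rewrite all_map; apply: sub_all (sample_generic Nm) => z /=; rewrite intr_eq0.
  by rewrite -(inj_eq (can_inj int_of_ZK)).
have sampleN i : sample R N (N + i) = sample R N i by rewrite /sample modnDl.
(* The polygon [up] moves from u at parameter 0 to the sample at parameter 1. *)
pose line (a b : R) : {poly R} := a%:P + (b - a)%:P * 'X.
pose up i := (line (u i).1 (sample R N i).1, line (u i).2 (sample R N i).2).
have line0 a b : (line a b).[0] = a by rewrite /line !hornerE.
have line1 a b : (line a b).[1] = b by rewrite /line hornerD hornerM !hornerC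
  hornerX mulr1 addrC subrK.
pose at_ (e : R) : {rmorphism {poly R} -> R} := horner_eval e.
have up0 : map_pair (at_ 0) \o up =1 u.
  by move=> i; rewrite [RHS]surjective_pairing; congr (_, _); apply: line0.
have up1 : map_pair (at_ 1) \o up =1 sample R N.
  by move=> i; rewrite [RHS]surjective_pairing; congr (_, _); apply: line1.
pose g : {poly R} := \prod_(z <- genericity N m up) z.
have gE e : g.[e] = \prod_(z <- genericity N m (map_pair (at_ e) \o up)) z.
  by rewrite -[LHS]/(at_ e g) rmorph_prod genericity_map_pair big_map.
have g0 : g != 0.
  apply/eqP => g0; have := gE 1; rewrite g0 horner0 => /esym/eqP; apply/negP.
  by rewrite (eq_genericity _ _ up1) prodf_seq_neq0; apply: sub_all W => z ->.
have [|c c0 cx] := @conic_of_minors (stars m (conic_pts u)) N.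
  move=> f.
  pose h : {poly R} := \det (\matrix_i monomials (stars m (conic_pts up) (f i))).
  have hE e : h.[e] = \det (\matrix_i monomials (stars m (conic_pts (map_pair
    (at_ e) \o up)) (f i))).
    rewrite -[LHS]/(at_ e h) -det_map_mx; congr (\det _); apply/matrixP => i j.
    rewrite [LHS]mxE [RHS]mxE stars_map_pair map_vec_monomials; congr (at_ e _);
      exact: mxE.
  (* Where g is nonzero the polygon is generic, has a conic, and the minor vanishes; so the minor is
     the zero polynomial and vanishes at parameter 0 too. *)
  have h0 : h = 0.
    apply: poly_eq0_of_vanish g0 _ => e; rewrite gE prodf_seq_neq0 => ge;
      rewrite hE.
    have [||c c0 cx] := @generic_conic _ N m (map_pair (at_ e) \o up) Nm.
    - by move=> i; rewrite /= /up uN sampleN.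
    - by apply: sub_all ge => z; rewrite implyTb.
    exact: conic_minors0 c0 cx.
  have := hE 0; rewrite h0 horner0 => /esym.
  by under eq_mx do rewrite (eq_stars _ up0).
exists c => // i; rewrite (periodic_mod _ (stars_periodic m uN)).
exact: (cx (Ordinal (ltn_pmod i N0))).
Qed.
End Density.

(** * From a quadratic form to a non-degenerate conic *)

Section Real.
Variable R : realFieldType.
Implicit Types (a b c v w : vec R) (k : vec R * vec R).

Lemma dot_gt0 v : v <> (0, 0, 0) -> 0 < dot v v.
Proof.
case: v => [[x y] z] n0; rewrite /dot /= -!expr2 lt0r andbC.
rewrite !addr_ge0 ?sqr_ge0 //=; apply/eqP => /eqP.
rewrite !paddr_eq0 ?addr_ge0 ?sqr_ge0 // !sqrf_eq0.
by move=> /andP[/andP[/eqP x0 /eqP y0] /eqP z0]; apply: n0; rewrite x0 y0 z0.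
Qed.

Lemma det3_cross a b : det3 a b (cross a b) = dot (cross a b) (cross a b).
Proof. vec_ring. Qed.

(** A point equal to a vertex of the frame has two zero coordinates, so all products of two
    coordinates vanish; likewise for the other two vertices. *)
Lemma cross_coords_l a b c v : cross a v = (0, 0, 0) ->
  cross_terms (coords a b c v) = (0, 0, 0).
Proof.
move=> av.
have e1 : det3 a v c = 0.
  have -> : det3 a v c = dot c (cross a v) by clear; vec_ring.
  by rewrite av /dot /= !mulr0 !addr0.
have e2 : det3 a b v = 0.
  have -> : det3 a b v = - dot b (cross a v) by clear; vec_ring.
  by rewrite av /dot /= !mulr0 !addr0 oppr0.
by rewrite /cross_terms /coords /= e1 e2 !(mulr0, mul0r).
Qed.

Lemma cross_coords_m a b c v : cross b v = (0, 0, 0) ->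
  cross_terms (coords a b c v) = (0, 0, 0).
Proof.
move=> bv.
have e1 : det3 v b c = 0.
  have -> : det3 v b c = - dot c (cross b v) by clear; vec_ring.
  by rewrite bv /dot /= !mulr0 !addr0 oppr0.
have e2 : det3 a b v = 0.
  have -> : det3 a b v = dot a (cross b v) by clear; vec_ring.
  by rewrite bv /dot /= !mulr0 !addr0.
by rewrite /cross_terms /coords /= e1 e2 !(mulr0, mul0r).
Qed.

Lemma cross_coords_r a b c v : cross c v = (0, 0, 0) ->
  cross_terms (coords a b c v) = (0, 0, 0).
Proof.
move=> cv.
have e1 : det3 v b c = 0.
  have -> : det3 v b c = dot b (cross c v) by clear; vec_ring.
  by rewrite cv /dot /= !mulr0 !addr0.
have e2 : det3 a v c = 0.
  have -> : det3 a v c = - dot a (cross c v) by clear; vec_ring.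
  by rewrite cv /dot /= !mulr0 !addr0 oppr0.
by rewrite /cross_terms /coords /= e1 e2 !(mulr0, mul0r).
Qed.

Lemma parallel v w : v <> (0, 0, 0) -> cross v w = (0, 0, 0) -> exists s, w =
  vscale s v.
Proof.
move=> /dot_gt0; rewrite lt0r => /andP[v0 _] vw; exists (dot v w / dot v v).
have : cross v (cross v w) = vadd (vscale (dot v w) v) (vscale (- dot v v) w) by
  clear; vec_ring.
rewrite vw /vadd /cross /vscale /= !(mulr0, subr0) => -[e1 e2 e3].
case: w e1 e2 e3 {vw} => [[w1 w2] w3] /= e1 e2 e3.
have h x y : 0 = dot v (w1, w2, w3) * x + - dot v v * y -> y = dot v (w1, w2,
  w3) / dot v v * x.
  move=> e; apply: (mulfI v0); apply/eqP; rewrite -subr_eq0; apply/eqP.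
  transitivity (- (dot v (w1, w2, w3) * x + - dot v v * y));
    last by rewrite -e oppr0.
  by move: (dot v v) v0 => d d0; field.
by congr (_, _, _); apply: h.
Qed.

Lemma quad_eq0 k : (forall v, quad k v = 0) -> k = ((0, 0, 0), (0, 0, 0)).
Proof.
case: k => [[[p q] r] [[s t] z]] H.
have := (H (1, 0, 0), H (0, 1, 0), H (0, 0, 1), H (0, 1, 1), H (1, 0, 1), H (1,
  1, 0)).
rewrite /quad /dot /squares /cross_terms /= !(mulr0, mul0r, mulr1, addr0, add0r).
by move=> [[[[[-> ->] ->] h1] h2] h3]; rewrite !(add0r, addr0) in h1 h2 h3;
  rewrite h1 h2 h3.
Qed.

Lemma formof_inj0 (c : 'rV[R]_6) : formof c = ((0, 0, 0), (0, 0, 0)) -> c = 0.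
Proof.
case=> e0 e1 e2 e3 e4 e5; apply/rowP => j; rewrite mxE.
have jE : j = inord j by apply/val_inj; rewrite /= inordK.
rewrite jE; case: j {jE} => [[|[|[|[|[|[|j]]]]]] j6] //=.
Qed.

(* A conic through p, q, r has the equation al yz + be xz + ga xy = 0 in the
   coordinates defined by p, q, r; it is non-degenerate when al, be, ga are
   nonzero. *)
Definition circumconic I (x : I -> vec R) (p q r : vec R) (al be ga : R) :=
  [/\ det3 p q r != 0, [/\ al != 0, be != 0 & ga != 0] &
   forall i, dot (al, be, ga) (cross_terms (coords p q r (x i))) = 0].

(** Three cases, by the number of distinct points off the triangle: for none or one a conic is
    written down; for two or more the given form is itself non-degenerate. *)
Lemma circumconic_triangle (I : finType) (x : I -> vec R) k :
  (forall i j l, cross (x i) (x j) <> (0, 0, 0) -> cross (x j) (x l) <> (0, 0,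
    0) ->
     cross (x i) (x l) <> (0, 0, 0) -> det3 (x i) (x j) (x l) != 0) ->
  k <> ((0, 0, 0), (0, 0, 0)) -> (forall i, quad k (x i) = 0) ->
  forall i j l, cross (x i) (x j) <> (0, 0, 0) -> cross (x j) (x l) <> (0, 0,
    0) ->
     cross (x i) (x l) <> (0, 0, 0) ->
  exists al be ga, circumconic x (x i) (x j) (x l) al be ga.
Proof.
move=> gp k0 kx i j l ij jl il; have D := gp _ _ _ ij jl il.
pose ct s := cross_terms (coords (x i) (x j) (x l) (x s)).
pose out s := [&& cross (x i) (x s) != (0, 0, 0), cross (x j) (x s) != (0, 0,
  0) & cross (x l) (x s) != (0, 0, 0)].
have ct_in s : ~~ out s -> ct s = (0, 0, 0).
  rewrite /out; case: eqP => [/cross_coords_l e _|_]; first exact: e.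
  case: eqP => [/cross_coords_m e _|_]; first exact: e.
  case: eqP => [/cross_coords_r e _|_] //; exact: e.
have crC v w : cross v w <> (0, 0, 0) -> cross w v <> (0, 0, 0).
  move=> vw wv; apply: vw; have -> : cross v w =
    vscale (-1) (cross w v) by clear; vec_ring.
  by rewrite wv /vscale /= !mulr0.
have outP s : out s -> [/\ det3 (x s) (x j) (x l) != 0,
  det3 (x i) (x s) (x l) != 0 & det3 (x i) (x j) (x s) != 0].
  by move=> /and3P[/eqP si /eqP sj /eqP sl]; split; apply: gp => //; apply: crC.
pose K := polars k (x i) (x j) (x l).
have KE v : det3 (x i) (x j) (x l) ^+ 2 * quad k v =
    dot K (cross_terms (coords (x i) (x j) (x l) v)).
  rewrite -quad_vscale -comb_coords quad_comb !kx.
  by rewrite [dot (0, 0, 0) _]/dot /= !mul0r !add0r.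
have Kct s : dot K (ct s) = 0 by rewrite -KE kx mulr0.
have K0 : K <> (0, 0, 0).
  move=> K0; apply: k0; apply: quad_eq0 => v; apply/eqP.
  rewrite -(mulrI_eq0 _ (mulfI (expf_neq0 2 D))) KE K0.
  by rewrite /dot /= !mul0r !addr0.
have [s s_out|no] := pickP out; last first.
  exists 1, 1, 1; split; rewrite ?oner_eq0 // => s.
  by rewrite -/(ct s) ct_in ?no // /dot /= !mulr0 !addr0.
have [s1 s2 s3] := outP _ s_out.
pose X s := det3 (x s) (x j) (x l); pose Y s := det3 (x i) (x s) (x l).
pose Z s := det3 (x i) (x j) (x s).
have [t /andP[t_out /eqP st]|no] := pickP (fun t =>
  out t && (cross (x s) (x t) != (0, 0, 0))); last first.
  (* All further points coincide with s, where the equation reads XYZ + XYZ - 2 XYZ = 0. *)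
  exists (X s), (Y s), (- (2 * Z s)); split; rewrite ?oppr_eq0 ?mulf_neq0
    ?pnatr_eq0 // => t.
  have [t_out|/ct_in] := boolP (out t); last first.
    by rewrite -/(ct t) => ->; rewrite /dot /= !mulr0 !addr0.
  have /negbT := no t; rewrite t_out /= negbK => /eqP /parallel[].
    by move=> xs0; move: s1; rewrite xs0 /det3 /dot /= !mul0r !addr0 eqxx.
  move=> z ->; rewrite /X /Y /Z.
  move: (x i) (x j) (x l) (x s); clear=> *; rewrite /cross_terms /coords;
    vec_ring.
have [t1 t2 t3] := outP _ t_out.
have ist : det3 (x i) (x s) (x t) != 0.
  by case/and3P: (s_out) (t_out) => /eqP ? _ _ /and3P[/eqP ? _ _]; apply: gp.
have jst : det3 (x j) (x s) (x t) != 0.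
  by case/and3P: (s_out) (t_out) => _ /eqP ? _ /and3P[_ /eqP ? _]; apply: gp.
have lst : det3 (x l) (x s) (x t) != 0.
  by case/and3P: (s_out) (t_out) => _ _ /eqP ? /and3P[_ _ /eqP ?]; apply: gp.
have D1 : Z s * Y t - Y s * Z t != 0.
  have -> : Z s * Y t - Y s * Z t = - det3 (x i) (x j) (x l) * det3 (x i) (x s)
    (x t).
    by rewrite /Y /Z; move: (x i) (x j) (x l) (x s) (x t); clear=> *; vec_ring.
  by rewrite mulf_neq0 ?oppr_eq0.
have D2 : Z s * X t - X s * Z t != 0.
  have -> : Z s * X t - X s * Z t = det3 (x i) (x j) (x l) * det3 (x j) (x s) (x
    t).
    by rewrite /X /Z; move: (x i) (x j) (x l) (x s) (x t); clear=> *; vec_ring.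
  by rewrite mulf_neq0.
have D3 : Y s * X t - X s * Y t != 0.
  have -> : Y s * X t - X s * Y t = - det3 (x i) (x j) (x l) * det3 (x l) (x s)
    (x t).
    by rewrite /X /Y; move: (x i) (x j) (x l) (x s) (x t); clear=> *; vec_ring.
  by rewrite mulf_neq0 ?oppr_eq0.
rewrite -/(X s) in s1; rewrite -/(Y s) in s2; rewrite -/(Z s) in s3.
rewrite -/(X t) in t1; rewrite -/(Y t) in t2; rewrite -/(Z t) in t3.
move: K K0 Kct {KE} => [[K1 K2] K3] K0 Kct.
have E r : K1 * (Y r * Z r) + K2 * (X r * Z r) + K3 * (X r * Y r) = 0 := Kct r.
have := E s; have := E t => et es.
have lin (p q a b c d : R) : p * a + q * b = 0 -> p * c + q * d = 0 ->
  a * d - b * c != 0 -> p = 0 /\ q = 0.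
  move=> e1 e2 n0; split; apply: (mulIf n0); rewrite mul0r.
    transitivity ((p * a + q * b) * d - (p * c + q * d) * b); first by ring.
    by rewrite e1 e2 !mul0r subr0.
  transitivity ((p * c + q * d) * a - (p * a + q * b) * c); first by ring.
  by rewrite e1 e2 !mul0r subr0.
exists K1, K2, K3; suff K_neq0 : [/\ K1 != 0, K2 != 0 & K3 != 0] by split.
(* If one coefficient is 0, the equations at s and t, divided by a nonzero coordinate, form a 2 by 2
   system of determinant D1, D2 or D3, which forces K = 0. *)
split; apply/eqP => E0; apply: K0; rewrite E0 ?mul0r ?add0r ?addr0 in es et *.
- have [-> ->] // : K2 = 0 /\ K3 = 0; apply: lin D1.
  + by apply: (mulfI s1); rewrite mulr0 -es; ring.
  + by apply: (mulfI t1); rewrite mulr0 -et; ring.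
- have [-> ->] // : K1 = 0 /\ K3 = 0; apply: lin D2.
  + by apply: (mulfI s2); rewrite mulr0 -es; ring.
  + by apply: (mulfI t2); rewrite mulr0 -et; ring.
- have [-> ->] // : K1 = 0 /\ K2 = 0; apply: lin D3.
  + by apply: (mulfI s3); rewrite mulr0 -es; ring.
  + by apply: (mulfI t3); rewrite mulr0 -et; ring.
Qed.

Lemma nonparallel v : v <> (0, 0, 0) -> exists w, cross v w <> (0, 0, 0).
Proof.
case: v => [[x y] z] v0.
have [x0|x0] := eqVneq x 0; last first.
  by exists (0, 1, 0); rewrite /cross /= => -[_ _ /eqP];
    rewrite mulr1 mulr0 subr0 (negPf x0).
have [y0|y0] := eqVneq y 0; last first.
  by exists (0, 0, 1); rewrite /cross /= => -[/eqP + _ _];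
    rewrite mulr1 mulr0 subr0 (negPf y0).
exists (1, 0, 0); rewrite /cross /= => -[_ /eqP + _];
  rewrite mulr1 mulr0 subr0 => /eqP z0.
by rewrite x0 y0 z0 in v0.
Qed.

(** Families with at most two distinct points are completed to a triangle by the cross product of
    two vectors. *)
Lemma circumconic_exists (I : finType) (x : I -> vec R) (c : 'rV[R]_6) :
  (forall i, x i <> (0, 0, 0)) ->
  (forall i j l, cross (x i) (x j) <> (0, 0, 0) -> cross (x j) (x l) <> (0, 0,
    0) ->
     cross (x i) (x l) <> (0, 0, 0) -> det3 (x i) (x j) (x l) != 0) ->
  c != 0 -> (forall i, quad (formof c) (x i) = 0) ->
  exists p q r al be ga, circumconic x p q r al be ga.
Proof.
move=> x0 gp c0 cx.
have two a b : cross a b <> (0, 0, 0) ->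
    (forall i, cross a (x i) = (0, 0, 0) \/ cross b (x i) = (0, 0, 0)) ->
    exists p q r al be ga, circumconic x p q r al be ga.
  move=> ab xab; exists a, b, (cross a b), 1, 1, 1; split; rewrite ?oner_eq0 //.
    by rewrite det3_cross gt_eqF ?dot_gt0.
  move=> i; have [/cross_coords_l ->|/cross_coords_m ->] := xab i;
  by rewrite /dot /= !mulr0 !addr0.
have [i _|noI] := pickP (@predT I); last first.
  have e1 : ((1, 0, 0) : vec R) <> (0, 0, 0) by case=> /eqP; rewrite oner_eq0.
  by have [w /two] := nonparallel e1; apply=> i; have := noI i.
have [j /eqP ij|noj] := pickP (fun j => cross (x i) (x j) != (0, 0, 0));
  last first.
  have [w /two] := nonparallel (x0 i); apply=> j; left.
  by apply/eqP; have /negbT := noj j; rewrite negbK.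
have [l /andP[/eqP il /eqP jl]|nol] := pickP (fun l => (cross (x i) (x l) != (0,
  0, 0)) && (cross (x j) (x l) != (0, 0, 0))); last first.
  apply: (two _ _ ij) => l; have := nol l.
  by case: eqP => [|_]; [left | case: eqP => // ? _; right].
exists (x i), (x j), (x l); apply: circumconic_triangle gp _ cx _ _ _ ij jl il.
by move=> /formof_inj0/eqP; apply/negP.
Qed.

Lemma vec_eq0 v : v.1.1 = 0 -> v.1.2 = 0 -> v.2 = 0 -> v = (0, 0, 0).
Proof. by case: v => [[? ?] ?] /= -> -> ->. Qed.

Lemma scaled_conic (al be ga D x y z : R) :
  al != 0 -> be != 0 -> ga != 0 -> D != 0 ->
  al * (y * z) + be * (x * z) + ga * (x * y) = 0 ->
  y / D / be * (z / D / ga) + x / D / al * (z / D / ga) + x / D / al * (y / D /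
    be) = 0.
Proof.
move=> al0 be0 ga0 D0 e.
transitivity ((al * (y * z) + be * (x * z) + ga * (x * y)) / (al * be * ga * D
  ^+ 2)).
  by field; rewrite al0 be0 ga0 D0.
by rewrite e mul0r.
Qed.

Lemma circumconic_frame I (x : I -> vec R) p q r al be ga :
  (forall i, x i <> (0, 0, 0)) -> circumconic x p q r al be ga ->
  exists a b d, det3 a b d != 0 /\ forall i, exists s,
    [/\ s.2 ^+ 2 = s.1.1 ^+ 2 + s.1.2 ^+ 2, s.2 != 0 & x i = comb a b d s].
Proof.
move=> x0 [D [al0 be0 ga0] xf].
have h2 : (2 : R) != 0 by rewrite pnatr_eq0.
pose h : R := 2^-1.
(* This frame inverts s = (X - Y, 2Z, X + Y + 2Z), for which s_2^2 - s_0^2 - s_1^2 = 4 (YZ + XZ +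
   XY); X, Y, Z are coordinates divided by al, be, ga. *)
pose a := vadd (vscale (h * al) p) (vscale (- (h * be)) q).
pose b := vadd (vadd (vscale (- (h * al)) p) (vscale (- (h * be)) q)) (vscale (h
  * ga) r).
pose d := vadd (vscale (h * al) p) (vscale (h * be) q).
exists a, b, d; split.
  have -> : det3 a b d = - (h * h * h * 2) * (al * be * ga * det3 p q r).
    by rewrite /a /b /d; clear; vec_ring.
  by rewrite !mulf_neq0 ?oppr_eq0 ?mulf_neq0 ?invr_eq0.
move=> i; pose X := det3 (x i) q r / det3 p q r / al.
pose Y := det3 p (x i) r / det3 p q r / be.
pose Z := det3 p q (x i) / det3 p q r / ga.
have XYZ : Y * Z + X * Z + X * Y = 0.
  exact: scaled_conic (xf i).
pose s : vec R := (X - Y, 2 * Z, X + Y + 2 * Z).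
have xE : x i = comb a b d s.
  have -> : comb a b d s = comb p q r (al * X, be * Y, ga * Z).
    rewrite /comb /a /b /d /s /h; move: X Y Z {s XYZ}.
    move: p q r {D xf a b d}; clear -h2 => [[[p1 p2] p3]] [[q1 q2] q3] [[r1 r2]
      r3] X Y Z.
    by rewrite /vadd /vscale /=; congr (_, _, _); field.
  have -> : (al * X, be * Y, ga * Z) = vscale (det3 p q r)^-1 (coords p q r (x
    i)).
    by rewrite /X /Y /Z /vscale /=; congr (_, _, _); field; apply/andP.
  have := comb_coords p q r (x i); move: (coords p q r (x i)) => w e.
  have -> : comb p q r (vscale (det3 p q r)^-1 w) =
    vscale (det3 p q r)^-1 (comb p q r w).
    by clear; rewrite /comb; move: (det3 p q r)^-1 => t; vec_ring.
  by rewrite e vscaleA mulVf //; case: (x i) => [[? ?] ?];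
    rewrite /vscale /= !mul1r.
have sE : s.2 ^+ 2 = s.1.1 ^+ 2 + s.1.2 ^+ 2.
  rewrite /s /=; transitivity ((X - Y) ^+ 2 + (2 * Z) ^+ 2 + 4 * (Y * Z + X * Z
    + X * Y)).
    by ring.
  by rewrite XYZ mulr0 addr0.
exists s; split=> //; apply/eqP => s2.
move: sE; rewrite s2 expr0n /= => /esym/eqP.
rewrite paddr_eq0 ?sqr_ge0 // !sqrf_eq0 => /andP[/eqP s0 /eqP s1].
apply: (x0 i); rewrite xE (_ : s = (0, 0, 0)).
  by rewrite /comb /vadd /vscale /= !(mul0r, addr0).
exact: (vec_eq0 (v := s)).
Qed.

End Real.

(** * Coordinates on the plane and on its dual *)

Section Coordinates.
Variable R : realType.

Definition row3 (a : vec R) : 'rV[R]_3 := \row_j [:: a.1.1; a.1.2; a.2]`_j.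
Definition vec3_of (v : 'rV[R]_3) : vec R := (v 0 0, v 0 1, v 0 2).

Lemma row3K a : vec3_of (row3 a) = a.
Proof. by case: a => [[x y] z]; rewrite /vec3_of !mxE. Qed.

Lemma vec3_ofK v : row3 (vec3_of v) = v.
Proof.
apply/rowP => j; rewrite mxE; case: j => [[|[|[|j]]] j3] //=; congr (v 0 _);
  exact/val_inj.
Qed.

Lemma row3_vadd a b : row3 (vadd a b) = row3 a + row3 b.
Proof. by apply/rowP => j; rewrite !mxE; case: j => [[|[|[|j]]] j3]. Qed.

Lemma row3_vscale k a : row3 (vscale k a) = k *: row3 a.
Proof. by apply/rowP => j; rewrite !mxE; case: j => [[|[|[|j]]] j3]. Qed.

Lemma row3_0 : row3 (0, 0, 0) = 0.
Proof. by apply/rowP => j; rewrite !mxE; case: j => [[|[|[|j]]] j3]. Qed.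

Lemma dotC (a b : vec R) : dot a b = dot b a.
Proof. by clear; vec_ring. Qed.

Lemma mul_row3 a b : row3 a *m (row3 b)^T = (dot a b)%:M.
Proof.
apply/matrixP => i j; rewrite !ord1 !mxE !big_ord_recl big_ord0 !mxE /= mulr1n.
by rewrite /dot addr0 addrA.
Qed.

Lemma common_line (a b : vec R) : cross a b = (0, 0, 0) ->
  exists p s t, [/\ p <> (0, 0, 0), a = vscale s p & b = vscale t p].
Proof.
have sc0 (p : vec R) : vscale 0 p = (0, 0, 0) by rewrite /vscale !mul0r.
have sc1 (p : vec R) : vscale 1 p = p by case: p => [[? ?] ?];
  rewrite /vscale /= !mul1r.
have [-> _|/eqP a0 ab] := eqVneq a (0, 0, 0); last first.
  by have [t ->] := parallel a0 ab; exists a, 1, t; rewrite sc1.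
have [->|/eqP b0] := eqVneq b (0, 0, 0).
  exists (1, 0, 0), 0, 0; rewrite !sc0; split => //.
  by case=> /eqP; rewrite oner_eq0.
by exists b, 0, 1; rewrite sc0 sc1.
Qed.

Lemma perp_pair (a b : vec R) : cross a b = (0, 0, 0) ->
  exists c d, [/\ dot c a = 0, dot c b = 0, dot d a = 0, dot d b =
    0 & cross c d <> (0, 0, 0)].
Proof.
move=> /common_line[p [s [t [p0 -> ->]]]].
have [w pw] := nonparallel p0; exists (cross p w), (cross p (cross p w)).
split; try by clear; vec_ring.
have -> : cross (cross p w) (cross p (cross p w)) =
  vscale (dot (cross p w) (cross p w)) p by clear; vec_ring.
move=> e; apply: p0; move: e; case: (p) (dot_gt0 pw) =>
  [[x y] z] /= /lt0r_neq0 d0.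
by rewrite /vscale /= => -[/eqP + /eqP + /eqP];
  rewrite !mulf_eq0 !(negPf d0) /= => /eqP-> /eqP-> /eqP->.
Qed.

Section Frame.
Variables (V : vectType R) (phi : 'Hom('rV[R]_3, V)).

Definition point_of (a : vec R) : V := phi (row3 a).

Lemma point_of_vadd a b : point_of (vadd a b) = point_of a + point_of b.
Proof. by rewrite /point_of row3_vadd linearD. Qed.

Lemma point_of_vscale k a : point_of (vscale k a) = k *: point_of a.
Proof. by rewrite /point_of row3_vscale linearZ. Qed.

Hypothesis phi_bij : bijective phi.

Lemma point_of_surj v : exists a, v = point_of a.
Proof.
by have [g gK fK] := phi_bij; exists (vec3_of (g v));
  rewrite /point_of vec3_ofK fK.
Qed.

Lemma point_of_inj : injective point_of.
Proof.
by move=> a b /(bij_inj phi_bij)/(congr1 vec3_of); rewrite !row3K.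
Qed.

Lemma point_of_eq0 a : point_of a = 0 -> a = (0, 0, 0).
Proof. by move=> a0; apply: point_of_inj; rewrite a0 /point_of row3_0 linear0.
  Qed.

Lemma mem_point_line a b : point_of b \in <[point_of a]>%VS -> exists k, b =
  vscale k a.
Proof. by case/vlineP => k e; exists k; apply: point_of_inj;
  rewrite e point_of_vscale. Qed.

Lemma dim_point_line (a : vec R) : \dim <[point_of a]>%VS = 1%N -> a <> (0, 0, 0).
Proof. by move=> + a0; rewrite a0 /point_of row3_0 linear0 dim_vline eqxx. Qed.

Lemma line_of_dim1 (U : {vspace V}) : \dim U = 1%N -> exists2 a, a <> (0, 0,
  0) & U = <[point_of a]>%VS.
Proof.
move=> dU; have [a ea] := point_of_surj (vpick U).
have UE : U = <[point_of a]>%VS.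
  apply/esym/eqP; rewrite eqEdim -memvE -ea memv_pick dim_vline vpick0 -dimv_eq0
    dU.
  by [].
exists a => //; apply: dim_point_line; by rewrite -UE.
Qed.

Lemma cross_neq0_of_dim2 (a b : vec R) : \dim (<[point_of a]> + <[point_of
  b]>)%VS = 2%N -> cross a b <> (0, 0, 0).
Proof.
move=> det2 ab.
have [p [s [t [_ ea eb]]]] := common_line ab.
have : (\dim (<[point_of a]> + <[point_of b]>)%VS <= 1)%N.
  apply: (@leq_trans (\dim <[point_of p]>%VS)); last by rewrite dim_vline;
    case: eqP.
  apply: dimvS; rewrite subv_add -!memvE ea eb !point_of_vscale.
  by rewrite !memvZ ?memv_line.
by rewrite det2.
Qed.

End Frame.

(** Covers [ann] and [preann] at once, so that both directions of duality share one proof. *)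
Definition annihilator (V W : vectType R) (phi : 'Hom('rV[R]_3,
  V)) (psi : 'Hom('rV[R]_3, W))
  (op : {vspace V} -> {vspace W}) :=
  forall (U : {vspace V}) b, reflect (forall a, point_of phi a \in U ->
    dot b a = 0) (point_of psi b \in op U).

Section Dual.
Variables (V W : vectType R) (phi : 'Hom('rV[R]_3, V)) (psi : 'Hom('rV[R]_3, W)).
Variable op : {vspace V} -> {vspace W}.
Hypotheses (phi_bij : bijective phi) (psi_bij : bijective psi) (opP :
  annihilator phi psi op).

Lemma mem_join a b c :
  reflect (dot c a = 0 /\ dot c b = 0) (point_of psi c \in op (<[point_of phi
    a]> + <[point_of phi b]>)%VS).
Proof.
apply: (iffP (opP _ _)) => [H|[ca cb] d].
  split; apply: H; first by rewrite (subvP (addvSl _ _)) ?memv_line.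
  by rewrite (subvP (addvSr _ _)) ?memv_line.
case/memv_addP => _ /vlineP[s ->] [_ /vlineP[t ->]].
rewrite -!point_of_vscale -point_of_vadd => /(point_of_inj phi_bij) ->.
have -> : dot c (vadd (vscale s a) (vscale t b)) =
  s * dot c a + t * dot c b by clear; vec_ring.
by rewrite ca cb !mulr0 addr0.
Qed.

Lemma join_line a b : \dim (op (<[point_of phi a]> + <[point_of phi b]>)%VS) =
  1%N ->
  op (<[point_of phi a]> + <[point_of phi b]>)%VS =
    <[point_of psi (cross a b)]>%VS.
Proof.
move=> d1; have [e e0 eE] := line_of_dim1 psi_bij d1.
(* Otherwise the annihilator would contain two independent vectors, against its dimension 1. *)
have ab : cross a b <> (0, 0, 0).
  move=> /perp_pair[c [d [ca cb da db]]]; apply.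
  have /mem_join : dot c a = 0 /\ dot c b = 0 by [].
  have /mem_join : dot d a = 0 /\ dot d b = 0 by [].
  rewrite eE => /(mem_point_line psi_bij)[s ->] /(mem_point_line psi_bij)[t ->].
  by clear; case: e => [[? ?] ?]; rewrite /cross /vscale /=; congr (_, _, _);
    ring.
apply/vspaceP => w; have [c ->] := point_of_surj psi_bij w.
apply/mem_join/idP => [[ca cb]|/(mem_point_line psi_bij)[s ->]].
  by have [s ->] := orthogonal_cross ab ca cb;
    rewrite point_of_vscale memvZ ?memv_line.
by split; clear; vec_ring.
Qed.

End Dual.

Section DualFrame.
Variable phi : 'Hom('rV[R]_3, 'rV[R]_3).

(** The functional with coordinates b in the basis dual to the frame phi; in such coordinates
    evaluation is [dot]. *)
Definition pairing (b w : vec3 R) : R^o := (b *m (phi^-1%VF w)^T) 0 0.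

Fact pairing_is_linear b : linear (pairing b).
Proof.
by move=> k v w; rewrite /pairing !linearP /= !mxE.
Qed.
HB.instance Definition _ b :=
  GRing.isLinear.Build R (vec3 R) R^o _ (pairing b) (pairing_is_linear b).

Definition dual_row (b : vec3 R) : covec3 R := linfun (pairing b).

Fact dual_row_is_linear : linear dual_row.
Proof.
move=> k b c; apply/lfunP => w; rewrite add_lfunE scale_lfunE !lfunE /=.
by rewrite /pairing mulmxDl -scalemxAl !mxE.
Qed.
HB.instance Definition _ :=
  GRing.isLinear.Build R (vec3 R) (covec3 R) _ dual_row dual_row_is_linear.

Definition dual_frame : 'Hom(vec3 R, covec3 R) := linfun dual_row.

Hypothesis phi_bij : bijective phi.

Lemma dual_frameE b a : point_of dual_frame b (point_of phi a) = dot b a.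
Proof.
rewrite /point_of /dual_frame !lfunE /= /pairing lker0_lfunK;
  last by apply/lker0P/bij_inj.
by rewrite mul_row3 mxE mulr1n.
Qed.

Lemma dual_frame_bij : bijective dual_frame.
Proof.
pose e j : vec R := vec3_of (delta_mx 0 j).
pose g (f : covec3 R) : vec3 R := \row_j f (point_of phi (e j)).
have gK : cancel dual_frame g.
  move=> b; apply/rowP => j; rewrite mxE -[b]vec3_ofK -/(point_of _ _)
    dual_frameE.
  by rewrite /e -{2}[vec3_of b]row3K; case: (vec3_of b) => [[? ?] ?];
    rewrite !mxE /dot /=; case: j => [[|[|[|j]]] j3] //=;
      rewrite !mxE /= ?(mulr0, mulr1, addr0, add0r).
exists g => // f; apply/lfunP => w; have [a ->] := point_of_surj phi_bij w.
rewrite -{1}[g f]vec3_ofK -/(point_of _ _) dual_frameE.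
have aE : row3 a = a.1.1 *: row3 (e 0) + a.1.2 *: row3 (e 1) + a.2 *: row3 (e 2).
  rewrite /e !vec3_ofK; apply/rowP => j; rewrite !mxE.
  case: j => [[|[|[|j]]] j3] //=; rewrite ?(mulr0, mulr1, addr0, add0r) //.
have -> : point_of phi a = a.1.1 *: point_of phi (e 0) + a.1.2 *: point_of phi
  (e 1) + a.2 *: point_of phi (e 2).
  by rewrite {1}/point_of aE !linearD !linearZ.
rewrite !linearD !linearZ /= /dot /vec3_of /g !mxE /=.
by rewrite ![_ *: f _]mulrC.
Qed.

Lemma ann_annihilator : annihilator phi dual_frame (@ann R).
Proof.
move=> U b; apply: (iffP (mem_ann _ _)) => [H a aU|H v].
  by rewrite -dual_frameE H.
by have [a ->] := point_of_surj phi_bij v => /H; rewrite dual_frameE.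
Qed.

Lemma preann_annihilator : annihilator dual_frame phi (@preann R).
Proof.
move=> U b; apply: (iffP (mem_preann _ _)) => [H a aU|H f].
  by rewrite dotC -dual_frameE H.
by have [a ->] := point_of_surj dual_frame_bij f => /H; rewrite dual_frameE dotC.
Qed.

End DualFrame.

Lemma comb_linear (a b d v w : vec R) k :
  comb a b d (vadd (vscale k v) w) = vadd (vscale k (comb a b d v)) (comb a b d
    w).
Proof. by clear; rewrite /comb; vec_ring. Qed.

Lemma comb_vscale (a b d v : vec R) k : comb a b d (vscale k v) =
  vscale k (comb a b d v).
Proof. by clear; rewrite /comb; vec_ring. Qed.

Lemma coords_comb (a b d v : vec R) :
  coords a b d (comb a b d v) = vscale (det3 a b d) v.
Proof. by clear; rewrite /comb /coords; vec_ring. Qed.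

Section Comb.
Variables (a b d : vec R).

Definition comb_row (v : vec3 R) : vec3 R := row3 (comb a b d (vec3_of v)).

Fact comb_row_is_linear : linear comb_row.
Proof.
move=> k v w; rewrite /comb_row -row3_vscale -row3_vadd; congr row3.
have -> : vec3_of (k *: v + w) = vadd (vscale k (vec3_of v)) (vec3_of w).
  by rewrite /vec3_of !mxE.
exact: comb_linear.
Qed.
HB.instance Definition _ :=
  GRing.isLinear.Build R (vec3 R) (vec3 R) _ comb_row comb_row_is_linear.

Lemma comb_row_bij : det3 a b d != 0 -> bijective (linfun comb_row).
Proof.
move=> D; exists (fun v => row3 (vscale (det3 a b d)^-1 (coords a b d (vec3_of
  v)))) => v.
  rewrite lfunE /= /comb_row row3K.
  rewrite coords_comb.
  by rewrite row3_vscale row3_vscale scalerA mulVf // scale1r vec3_ofK.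
rewrite lfunE /= /comb_row row3K.
by rewrite comb_vscale comb_coords !row3_vscale scalerA mulVf // scale1r vec3_ofK.
Qed.

Lemma point_of_comb (V : vectType R) (phi : 'Hom(vec3 R, V)) w :
  point_of (phi \o linfun comb_row)%VF w = point_of phi (comb a b d w).
Proof. by rewrite /point_of comp_lfunE lfunE /= /comb_row row3K. Qed.

End Comb.

Lemma comp_lfun_bij (U V W : vectType R) (f : 'Hom(V, W)) (g : 'Hom(U, V)) :
  bijective f -> bijective g -> bijective (f \o g)%VF.
Proof.
move=> [f' fK f'K] [g' gK g'K]; exists (g' \o f') => x /=; rewrite comp_lfunE.
  by rewrite fK gK.
by rewrite g'K f'K.
Qed.

(** The parametrization (s^2 - t^2, 2st, s^2 + t^2) of the cone: take s = z + x and t = y, except at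
    the point with z + x = 0, where (s, t) = (0, 1). *)
Lemma std_param (v : vec3 R) : v 0 2 ^+ 2 = v 0 0 ^+ 2 + v 0 1 ^+ 2 ->
  v 0 2 ^+ 2 != 0 ->
  exists u, <[v]>%VS = <[row3 (comb (1, 0, 1) (0, 2, 0) (-1, 0,
    1) (veronese u))%R]>%VS.
Proof.
move=> e z0.
suff [u [k [k0 E]]] : exists u k, k != 0 /\ comb (1, 0, 1) (0, 2, 0) (-1, 0,
  1) (veronese u) = vscale k (vec3_of v).
  exists u; rewrite E row3_vscale vec3_ofK; apply/esym/eqP.
  by rewrite eqEsubv -!memvE memvZ ?memv_line //= -{1}[v](scalerK k0) memvZ
    ?memv_line.
rewrite /vec3_of; move: (v 0 0) (v 0 1) (v 0 2) e z0 => x y z e z0.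
have [xz|xz] := eqVneq (z + x) 0.
  have y0 : y = 0.
    apply/eqP; rewrite -sqrf_eq0; apply/eqP.
    transitivity (z ^+ 2 - x ^+ 2); first by rewrite e; ring.
    by rewrite (_ : z = - x) ?sqrrN ?subrr //; apply/eqP; rewrite -addr_eq0 xz.
  have xE : x = - z by apply/eqP; rewrite -addr_eq0 addrC xz.
  have zn0 : z != 0 by rewrite expf_eq0 /= in z0.
  exists (0, 1), z^-1; rewrite invr_eq0; split => //.
  rewrite /comb /vadd /vscale /veronese /= y0 xE; congr (_, _, _); [|by ring|].
    by field.
  by field.
exists (z + x, y), (2 * (z + x)); split; first by rewrite mulf_neq0 ?pnatr_eq0.
have yy : y * y = (z + x) * (z - x).
  transitivity (z ^+ 2 - x ^+ 2); first by rewrite e; ring.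
  by ring.
rewrite /comb /vadd /vscale /veronese /= yy; congr (_, _, _); ring.
Qed.

Lemma inscribed_param N (P : 'Z_N -> {vspace vec3 R}) : inscribed P ->
  exists2 phi : 'Hom(vec3 R, vec3 R), bijective phi &
  exists u : 'Z_N -> R * R, forall i, P i = <[point_of phi (veronese (u i))]>%VS.
Proof.
case=> _ [phi phi_bij ->] PC.
exists (phi \o linfun (comb_row (1, 0, 1) (0, 2, 0) (-1, 0, 1)))%VF.
  apply: comp_lfun_bij phi_bij (comb_row_bij _).
  rewrite /det3 /dot /cross /= !(mulr0, mul0r, mulr1, mul1r, subr0, addr0, add0r).
  by rewrite mulrN1 opprK -natrD pnatr_eq0.
set psi := (_ \o _)%VF.
have /fin_all_exists[u Pu] : forall i, exists s, P i =
  <[point_of psi (veronese s)]>%VS.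
  move=> i; have [_ [v [e z0] <-] <-] := PC i.
  by have [s ->] := std_param e z0; exists s; rewrite limg_line point_of_comb.
by exists u.
Qed.

End Coordinates.

(** * Polygons *)

Section Final.
Variable R : realType.

Lemma ngon_join (V W : vectType R) (phi : 'Hom(vec3 R, V)) (psi : 'Hom(vec3 R,
  W)) op
    N k (A : 'Z_N -> {vspace V}) (B : 'Z_N -> {vspace W}) f :
  bijective phi -> bijective psi -> annihilator phi psi op ->
  (forall i, B i = op (A i + A (i + k%:R)%R)%VS) -> is_ngon B ->
  (forall i : nat, A i%:R = <[point_of phi (f i)]>%VS) ->
  forall i : nat, B i%:R = <[point_of psi (join k f i)]>%VS.
Proof.
move=> phi_bij psi_bij opP BE [dB _] Af i.
have := dB i%:R; rewrite BE -natrD addnC !Af; exact: join_line.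
Qed.

(** Two vectors of the cone orthogonal for x^2 + y^2 - z^2 are proportional, because a sum of two
    squares vanishes. This makes the point of contact unique. *)
Lemma cone_unique (s0 s1 s2 v0 v1 v2 : R) :
  s2 ^+ 2 = s0 ^+ 2 + s1 ^+ 2 -> s2 != 0 -> v2 ^+ 2 = v0 ^+ 2 + v1 ^+ 2 ->
  v0 * s0 + v1 * s1 = v2 * s2 -> v0 = v2 / s2 * s0 /\ v1 = v2 / s2 * s1.
Proof.
move=> es s0' ev vs.
have : (v0 * s2 - v2 * s0) ^+ 2 + (v1 * s2 - v2 * s1) ^+ 2 = 0.
  transitivity ((v0 ^+ 2 + v1 ^+ 2) * s2 ^+ 2 - 2 * v2 * s2 * (v0 * s0 + v1 * s1)
     + v2 ^+ 2 * (s0 ^+ 2 + s1 ^+ 2)); first by ring.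
  by rewrite -ev -es vs; ring.
move=> /eqP; rewrite paddr_eq0 ?sqr_ge0 // !sqrf_eq0 !subr_eq0 =>
  /andP[/eqP e0 /eqP e1].
by split; apply: (mulIf s0'); rewrite ?e0 ?e1; field.
Qed.

Section Circumscribed.
Variables (phi : 'Hom(vec3 R, vec3 R)) (N : nat) (A : 'Z_N -> {vspace covec3 R}).
Variable n : nat -> vec R.
Hypotheses (phi_bij : bijective phi) (Angon : is_ngon A).
Hypothesis An : forall i : nat, A i%:R = <[point_of (dual_frame phi) (n i)]>%VS.
Let x := join 1 n.

Lemma side_join (i : nat) :
  side A i%:R = (<[point_of (dual_frame phi) (n i)]> + <[point_of (dual_frame
    phi) (n i.+1)]>)%VS.
Proof. by rewrite /side -!An -natr1. Qed.

Lemma meet_neq0 i : x i <> (0, 0, 0).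
Proof.
have [_ /(_ i%:R)] := Angon; rewrite side_join; exact: cross_neq0_of_dim2.
Qed.

Lemma mem_side (i : nat) b :
  reflect (dot b (x i) = 0) (point_of (dual_frame phi) b \in side A i%:R).
Proof.
rewrite side_join; apply: (iffP idP).
  case/memv_addP => _ /vlineP[s ->] [_ /vlineP[t ->]].
  rewrite -!point_of_vscale -point_of_vadd => /(point_of_inj (dual_frame_bij
    phi_bij)) ->.
  by rewrite /x /join; move: (n i) (n _); clear=> *; vec_ring.
move=> bx; have := dot_gt0 (@meet_neq0 i); rewrite lt0r => /andP[d0 _].
(* Cramer's rule in the basis n_i, n_{i+1}, x_i; the coefficient of x_i is proportional to
   [dot b (x i)], which is 0. *)
have -> : b = vadd (vscale (dot (cross b (n i.+1)) (x i) / dot (x i) (x i)) (n i))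
                   (vscale (dot (cross (n i) b) (x i) / dot (x i) (x i)) (n
                     i.+1)).
  have H : vscale (dot (x i) (x i)) b = vadd (vscale (dot (cross b (n i.+1)) (x
    i)) (n i))
                   (vscale (dot (cross (n i) b) (x i)) (n i.+1)).
    transitivity (vadd (vadd (vscale (dot (cross b (n i.+1)) (x i)) (n i))
                   (vscale (dot (cross (n i) b) (x i)) (n i.+1))) (vscale (dot b
                     (x i)) (x i))).
      by rewrite /x /join; move: (n i) (n _); clear=> *; vec_ring.
    by rewrite bx /vadd /vscale /= !mul0r !addr0.
  have : vscale (dot (x i) (x i))^-1 (vscale (dot (x i) (x i)) b) = b.
    by rewrite vscaleA mulVf //; case: (b) => [[? ?] ?];
      rewrite /vscale /= !mul1r.
  have scD (k p q : R) v w :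
      vscale k (vadd (vscale p v) (vscale q w)) =
        vadd (vscale (p * k) v) (vscale (q * k) w).
    by clear; vec_ring.
  by rewrite H scD => /esym.
by rewrite point_of_vadd !point_of_vscale memv_add // memvZ ?memv_line.
Qed.

Lemma side_neq (i j : nat) : cross (x i) (x j) <> (0, 0, 0) ->
  side A i%:R != side A j%:R.
Proof.
move=> ij; apply/eqP => e.
have [w iw] := nonparallel (@meet_neq0 i).
have mem b : dot b (x i) = 0 -> dot b (x j) = 0.
  by move=> /mem_side; rewrite e => /mem_side.
have h w' : dot (cross (x i) w') (x j) = 0 by apply: mem; clear; vec_ring.
have hw w' : dot (cross (x i) (x j)) w' = 0.
  have -> : dot (cross (x i) (x j)) w' = - dot (cross (x i) w') (x j) by clear;
    vec_ring.
  by rewrite h oppr0.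
by have := dot_gt0 ij; rewrite hw ltxx.
Qed.

(** If x_i, x_j, x_l were dependent, the nonzero covector [cross (x i) (x j)] would vanish at all
    three and give a common point of the three sides. *)
Lemma general_position : no_three_sides_concurrent A -> forall i j l : nat,
  cross (x i) (x j) <> (0, 0, 0) -> cross (x j) (x l) <> (0, 0, 0) ->
  cross (x i) (x l) <> (0, 0, 0) -> det3 (x i) (x j) (x l) != 0.
Proof.
move=> gp i j l ij jl il; apply/eqP => B.
have := gp _ _ _ (side_neq ij) (side_neq jl) (side_neq il).
move=> cap0; have : point_of (dual_frame phi) (cross (x i) (x j)) \in (side A
  i%:R :&: side A j%:R :&: side A l%:R)%VS.
  rewrite !memv_cap; apply/andP; split; first apply/andP; try split;
    apply/mem_side.
  - by clear; vec_ring.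
  - by clear; vec_ring.
  - by rewrite -B; clear; vec_ring.
rewrite cap0 memv0 => /eqP /(point_of_eq0 (dual_frame_bij phi_bij)); exact: ij.
Qed.

(** The minus sign in d' turns the pairing of the two frames into x^2 + y^2 - z^2, for which the
    standard cone is self-dual. So the side x_i touches the dual conic at the point with the same
    coordinates s. *)
Lemma frame_circumscribed a b d : det3 a b d != 0 ->
  (forall i : 'Z_N, exists s, [/\ s.2 ^+ 2 = s.1.1 ^+ 2 + s.1.2 ^+ 2,
    s.2 != 0 & x i = comb a b d s]) ->
  circumscribed A.
Proof.
move=> D xs.
pose a' := cross b d; pose b' := cross d a; pose d' := vscale (-1) (cross a b).
have D' : det3 a' b' d' != 0.
  have -> : det3 a' b' d' = - det3 a b d ^+ 2 by rewrite /a' /b' /d'; clear;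
    vec_ring.
  by rewrite oppr_eq0 expf_neq0.
pose psi := (dual_frame phi \o linfun (comb_row a' b' d'))%VF.
have psi_bij : bijective psi := comp_lfun_bij (dual_frame_bij phi_bij)
  (comb_row_bij D').
exists [set (psi @: U)%VS | U in @std_conic R]%classic; first by exists psi.
move=> i0; have [_ dA] := Angon.
have -> : i0 = (i0 : nat)%:R :> 'Z_N by rewrite natr_Zp.
set i := (i0 : nat).
have [s [es s0 xE]] := xs i0.
have side_psi v : reflect (v.1.1 * s.1.1 + v.1.2 * s.1.2 =
  v.2 * s.2) (point_of psi v \in side A i%:R).
  rewrite /psi point_of_comb.
  have E : dot (comb a' b' d' v) (x i) = det3 a b d * (v.1.1 * s.1.1 + v.1.2 *
    s.1.2 - v.2 * s.2).
    by rewrite /i xE /comb /a' /b' /d'; clear; vec_ring.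
  apply: (iffP (mem_side _ _)); rewrite E.
    by move=> /eqP; rewrite mulf_eq0 (negPf D) /= subr_eq0 => /eqP.
  by move=> ->; rewrite subrr mulr0.
split; first exact: dA.
exists <[point_of psi s]>%VS; split.
  split.
    exists <[row3 s]>%VS; last by rewrite limg_line.
    exists (row3 s) => //; rewrite /= !mxE /=; split => //.
    by rewrite expf_neq0.
  by rewrite -memvE; apply/side_psi; rewrite -!expr2 es.
move=> _ [[_ [v [ev v0] <-] <-]]; rewrite limg_line -memvE.
rewrite -[v]vec3_ofK -/(point_of psi _) => /side_psi /= vs.
have [e0 e1] := cone_unique es s0 ev vs.
have v2 : v 0 2 != 0 by rewrite expf_eq0 /= in v0.
have k0 : v 0 2 / s.2 != 0 by rewrite mulf_neq0 ?invr_eq0.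
have -> : vec3_of v = vscale (v 0 2 / s.2) s.
  by rewrite /vec3_of e0 e1 /vscale divfK.
apply/eqP; rewrite point_of_vscale eqEsubv -!memvE memvZ ?memv_line // andbT.
by rewrite -{1}[point_of psi s](scalerK k0) memvZ ?memv_line.
Qed.

Lemma conic_circumscribed (c : 'rV[R]_6) : no_three_sides_concurrent A ->
  c != 0 -> (forall i, quad (formof c) (x i) = 0) -> circumscribed A.
Proof.
move=> gp c0 cx.
have [||||p [q [r [al [be [ga F]]]]]] := @circumconic_exists R 'Z_N (fun i =>
  x i) c => //.
- by move=> i; apply: meet_neq0.
- by move=> i j l; apply: general_position.
have [|a [b [d [D xs]]]] := circumconic_frame _ F; first by move=> i;
  apply: meet_neq0.
exact: frame_circumscribed D xs.
Qed.

End Circumscribed.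

Section Iterate.
Variables (N : nat) (P : 'Z_N -> {vspace vec3 R}) (phi : 'Hom(vec3 R, vec3 R)).
Variable f : nat -> vec R.
Hypotheses (phi_bij : bijective phi).
Hypothesis Pf : forall i : nat, P i%:R = <[point_of phi (f i)]>%VS.

Lemma T3_join : is_ngon (T 3 P) ->
  forall i : nat, T 3 P i%:R = <[point_of (dual_frame phi) (join 3 f i)]>%VS.
Proof.
by move=> ngon; apply: ngon_join phi_bij (dual_frame_bij phi_bij)
  (ann_annihilator phi_bij) _ ngon Pf.
Qed.

Lemma T'1_star : is_ngon (T 3 P) -> is_ngon (T' 1 (T 3 P)) ->
  forall i : nat, T' 1 (T 3 P) i%:R = <[point_of phi (star f i)]>%VS.
Proof.
move=> ngon ngon'; apply: ngon_join (dual_frame_bij phi_bij) phi_bij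
  (preann_annihilator phi_bij) _ ngon' (T3_join ngon) => //.
Qed.

End Iterate.

End Final.

Theorem theorem4 (R : realType) :
  (forall P : 'Z_8 -> {vspace vec3 R},
     is_ngon P -> inscribed P ->
     is_ngon (T 3 P) ->
     no_three_sides_concurrent (T 3 P) ->
     circumscribed (T 3 P))
  /\
  (forall P : 'Z_10 -> {vspace vec3 R},
     is_ngon P -> inscribed P ->
     is_ngon (T 3 P) -> is_ngon (T' 1 (T 3 P)) ->
     is_ngon (T 3 (T' 1 (T 3 P))) ->
     no_three_sides_concurrent (T 3 (T' 1 (T 3 P))) ->
     circumscribed (T 3 (T' 1 (T 3 P))))
  /\
  (forall P : 'Z_12 -> {vspace vec3 R},
     is_ngon P -> inscribed P ->
     is_ngon (T 3 P) -> is_ngon (T' 1 (T 3 P)) ->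
     is_ngon (T 3 (T' 1 (T 3 P))) ->
     is_ngon (T' 1 (T 3 (T' 1 (T 3 P)))) ->
     is_ngon (T 3 (T' 1 (T 3 (T' 1 (T 3 P))))) ->
     no_three_sides_concurrent (T 3 (T' 1 (T 3 (T' 1 (T 3 P))))) ->
     circumscribed (T 3 (T' 1 (T 3 (T' 1 (T 3 P)))))).
Proof.
have param N (P : 'Z_N -> {vspace vec3 R}) : (1 < N)%N -> inscribed P ->
    exists2 phi : 'Hom(vec3 R, vec3 R), bijective phi &
    exists2 u : nat -> R * R, (forall i, u (N + i)%N = u i) &
      forall i : nat, P i%:R = <[point_of phi (conic_pts u i)]>%VS.
  move=> N1 /inscribed_param[phi phi_bij [u Pu]]; exists phi => //.
  exists (fun i => u i%:R) => i; last exact: Pu.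
  (* N is 0 in ['Z_N] since N > 1, hence the periodicity. *)
  by rewrite natrD pchar_Zp // add0r.
split; [|split] => P _ /param[//|phi phi_bij [u uN Pu]] ngon1.
(* The sides of the final polygon, as points, are by computation the sequence [stars m], with m = 1,
   2, 3 in the three cases. *)
- move=> gp; have [c c0 cx] := @stars_conic R 8 1 u isT uN.
  apply: (conic_circumscribed phi_bij ngon1 (T3_join phi_bij Pu ngon1) gp c0);
    exact: cx.
- move=> ngon2 ngon3 gp; have [c c0 cx] := @stars_conic R 10 2 u isT uN.
  have P1 := T'1_star phi_bij Pu ngon1 ngon2.
  apply: (conic_circumscribed phi_bij ngon3 (T3_join phi_bij P1 ngon3) gp c0);
    exact: cx.
- move=> ngon2 ngon3 ngon4 ngon5 gp; have [c c0 cx] :=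
  @stars_conic R 12 3 u isT uN.
  have P1 := T'1_star phi_bij Pu ngon1 ngon2.
  have P2 := T'1_star phi_bij P1 ngon3 ngon4.
  apply: (conic_circumscribed phi_bij ngon5 (T3_join phi_bij P2 ngon5) gp c0);
    exact: cx.
Qed.
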